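(* Let $n\in\mathbb{N}$, let $f,g:\mathbb{R}^n\to\mathbb{R}$ be pdfs, and assume $g\in\mathcal{C}_0$. Then the following statements hold. (a) If $f\in\mathcal{C}_0$, there exists a sequence $\{h_m^g\}_{m\in\mathbb{N}}$ with $h_m^g\in\mathcal{M}_m^g$ for every $m$, such that $\lim_{m\to\infty}\|f-h_m^g\|_{\mathcal{L}_\infty}=0$. (b) If $f\in\mathcal{C}_b$ and $\mathbb{K}\subset\mathbb{R}^n$ is compact, there exists a sequence $\{h_m^g\}_{m\in\mathbb{N}}$ with $h_m^g\in\mathcal{M}_m^g$ for every $m$, such that $\lim_{m\to\infty}\|f-h_m^g\|_{\mathcal{L}_\infty(\mathbb{K})}=0$. (c) If $1<p<\infty$ and $f\in\mathcal{L}_p$, there exists a sequence $\{h_m^g\}_{m\in\mathbb{N}}$ with $h_m^g\in\mathcal{M}_m^g$ for every $m$, such that $\lim_{m\to\infty}\|f-h_m^g\|_{\mathcal{L}_p}=0$. (d) If $f$ is measurable, there exists a sequence $\{h_m^g\}_{m\in\mathbb{N}}$ with $h_m^g\in\mathcal{M}_m^g$ for every $m$, such that $\lim_{m\to\infty}h_m^g=f$ almost everywhere (with respect to Lebesgue measure). (e) If $\nu$ is a $\sigma$-finite Borel measure on $\mathbb{R}^n$ and $f$ is $\nu$-measurable, there exists a sequence $\{h_m^g\}_{m\in\mathbb{N}}$ with $h_m^g\in\mathcal{M}_m^g$ for every $m$, such that $\lim_{m\to\infty}h_m^g=f$ almost everywhere with respect to $\nu$. If instead of $g\in\mathcal{C}_0$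 one assumes that the pdf $g$ satisfies $g\in\mathcal{V}$, then the following statement also holds. (f) If $f\in\mathcal{C}$, there exists a sequence $\{h_m^g\}_{m\in\mathbb{N}}$ with $h_m^g\in\mathcal{M}_m^g$ for every $m$, such that $\lim_{m\to\infty}\|f-h_m^g\|_{\mathcal{L}_1}=0$.
   Context: Fix $n\in\mathbb{N}$; $\|\cdot\|_2$ is the Euclidean norm on $\mathbb{R}^n$, $\lambda$ is Lebesgue measure, $\mathbb{R}_+=(0,\infty)$, $[m]=\{1,\dots,m\}$, and $\mathbb{X}^{\complement}=\mathbb{R}^n\setminus\mathbb{X}$. A pdf is a function $f:\mathbb{R}^n\to\mathbb{R}$ with $f\ge 0$ everywhere and $\int f\,\mathrm{d}\lambda=1$. For a pdf $g$ and $m\in\mathbb{N}$, $\mathcal{M}_m^g$ is the set of all functions $h:\mathbb{R}^n\to\mathbb{R}$ of the form $h(x)=\sum_{i=1}^m c_i\frac{1}{\sigma_i^n}g\left(\frac{x-\mu_i}{\sigma_i}\right)$ with $\mu_i\in\mathbb{R}^n$, $\sigma_i\in\mathbb{R}_+$ for $i\in[m]$, and $c=(c_1,\dots,c_m)^\top\in\mathbb{S}^{m-1}=\{c\in\mathbb{R}^m:\sum_{i=1}^m c_i=1,\ c_i\ge 0\ \forall i\in[m]\}$. Norms: for $\mathbb{X}\subset\mathbb{R}^n$ and $1\le p<\infty$, $\|f\|_{\mathcal{L}_p(\mathbb{X})}=\left(\int|\mathbf{1}_{\mathbb{X}}f|^p\,\mathrm{d}\lambda\right)^{1/p}$, and $\|f\|_{\mathcal{L}_\infty(\mathbb{X})}=\inf\{a\ge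 0:\lambda(\{x\in\mathbb{X}:|f(x)|>a\})=0\}$; $f\in\mathcal{L}_p(\mathbb{X})$ means this quantity is finite. When $\mathbb{X}=\mathbb{R}^n$ one writes $\mathcal{L}_p$ and $\|\cdot\|_{\mathcal{L}_p}$. Function classes: $\mathcal{C}$ is the class of continuous functions $\mathbb{R}^n\to\mathbb{R}$; $\mathcal{C}_b=\mathcal{C}\cap\mathcal{L}_\infty$; $\mathcal{C}_0=\{f\in\mathcal{C}:\forall\epsilon>0\ \exists\text{ a compact }\mathbb{K}\subset\mathbb{R}^n\text{ such that }\|f\|_{\mathcal{L}_\infty(\mathbb{K}^{\complement})}<\epsilon\}$; $\mathcal{V}$ is the class of $f\in\mathcal{C}_0$ for which there exist $\beta,\theta\in\mathbb{R}_+$ such that $|f(x)|\le\beta(1+\|x\|_2)^{-n-\theta}$ for all $x\in\mathbb{R}^n$. *)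

(* Defs.v *)
From HB Require Import structures.
From mathcomp Require Import all_boot all_order all_algebra.
From mathcomp Require Import all_classical all_reals all_analysis.
From mathcomp Require Import measurable_realfun.

Set Implicit Arguments.
Unset Strict Implicit.
Unset Printing Implicit Defensive.
Import Order.TTheory GRing.Theory Num.Theory.
Import numFieldNormedType.Exports.
Local Open Scope classical_set_scope.
Local Open Scope ring_scope.

Section lebesgue_Rn.
Context (R : realType) (n : nat).
Implicit Types (a b : 'rV[R]_n) (X : set 'rV[R]_n).

Definition ocbox a b : set 'rV[R]_n :=
  [set x | forall i, a 0 i < x 0 i <= b 0 i].

Definition ocbox_volume a b : R := \prod_i Num.max 0 (b 0 i - a 0 i).

(* Covers are indexed by a subset D of nat, so that set0 has the empty cover;
   this matters only for n = 0, where no box is empty. *)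
Definition lebesgue_outer X : \bar R :=
  ereal_inf [set s | exists (D : set nat) (a b : nat -> 'rV[R]_n),
    X `<=` \bigcup_(k in D) ocbox (a k) (b k) /\
    s = \esum_(k in D) (ocbox_volume (a k) (b k))%:E].

Lemma ocbox_volume_ge0 a b : 0 <= ocbox_volume a b.
Proof. by apply: prodr_ge0 => i _; rewrite le_max lexx. Qed.

Lemma lebesgue_outer_ge0 X : (0 <= lebesgue_outer X)%E.
Proof.
apply: le_ereal_inf_tmp => _ [D [a [b [_ ->]]]].
by apply: esum_ge0 => k _; rewrite lee_fin ocbox_volume_ge0.
Qed.

Lemma lebesgue_outer0 : lebesgue_outer set0 = 0%E.
Proof.
apply/eqP; rewrite eq_le lebesgue_outer_ge0 andbT.
apply: ereal_inf_lbound; exists set0, (fun=> 0), (fun=> 0).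
by split => //; rewrite esum_set0.
Qed.

Lemma le_lebesgue_outer : {homo lebesgue_outer : A B / A `<=` B >-> (A <= B)%E}.
Proof.
move=> A B AB; apply: ereal_inf_le_tmp => s [D [a [b [BD sE]]]].
by exists D, a, b; split => //; apply: subset_trans BD.
Qed.

Lemma lebesgue_outer_sigma_subadditive : sigma_subadditive lebesgue_outer.
Proof.
move=> A; have [[i ioo]|] := pselect (exists i, lebesgue_outer (A i) = +oo%E).
  rewrite (eseries_pinfty _ _ ioo) ?leey// => k _.
  by rewrite -ltNye (lt_le_trans _ (lebesgue_outer_ge0 _)).
rewrite -forallNE => Aoo.
apply/lee_addgt0Pr => _/posnumP[e].
rewrite (le_trans _ (epsilon_trick _ _ _))//; last first.
  by move=> k; exact: lebesgue_outer_ge0.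
pose vol (G : set nat * (nat -> 'rV[R]_n) * (nat -> 'rV[R]_n)) k : \bar R :=
  (ocbox_volume (G.1.2 k) (G.2 k))%:E.
have vol0 G k : (0 <= vol G k)%E by rewrite lee_fin ocbox_volume_ge0.
pose P i G := A i `<=` \bigcup_(k in G.1.1) ocbox (G.1.2 k) (G.2 k) /\
  (\esum_(k in G.1.1) vol G k <=
     lebesgue_outer (A i) + (e%:num / (2 ^ i.+1)%:R)%:E)%E.
have [G PG] : {G & forall i, P i (G i)}.
  apply: (@choice _ _ P) => i.
  have fA : lebesgue_outer (A i) \is a fin_num.
    by rewrite ge0_fin_numE ?lebesgue_outer_ge0// ltey; apply/eqP/Aoo.
  have en1 : 0 < e%:num / (2 ^ i.+1)%:R by [].
  have [s [D [a [b [AD sE]]]] slt] := lb_ereal_inf_adherent en1 fA.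
  exists (D, a, b); split => //; rewrite -/(lebesgue_outer (A i)) in slt.
  by rewrite -sE; exact/ltW.
pose J i := (G i).1.1.
have /card_esym/ppcard_eqP[f] := card_nat2.
apply: (@le_trans _ _ (\esum_(i in setT) \esum_(k in J i) vol (G i) k)%E).
  rewrite esum_esum//; apply: ereal_inf_lbound.
  exists (f @^-1` (setT `*`` J)), (fun k => (G (f k).1).1.2 (f k).2),
    (fun k => (G (f k).1).2 (f k).2); split.
    move=> x [i _ /(PG i).1 [k Jk xk]].
    by exists (f^-1%FUN (i, k)); rewrite /= invK ?inE.
  rewrite (@reindex_esum _ _ _ (f @^-1` (setT `*`` J)) (setT `*`` J) f)//.
  split => //.
  - by move=> u v _ _; exact: (@inj _ _ _ f u v (mem_setT _) (mem_setT _)).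
  - by move=> y Jy; exists (f^-1%FUN y); rewrite /= invK ?inE.
rewrite -nneseries_esumT//; last by move=> i; exact: esum_ge0.
apply: lee_nneseries => [i _ _|i _]; first exact: esum_ge0.
exact: (PG i).2.
Qed.

HB.instance Definition _ := isOuterMeasure.Build R 'rV[R]_n lebesgue_outer
  lebesgue_outer0 lebesgue_outer_ge0 le_lebesgue_outer
  lebesgue_outer_sigma_subadditive.

(* The points of R^n with the Lebesgue sigma-algebra, i.e., the sets that are
   Caratheodory-measurable for the Lebesgue outer measure. *)
Definition lebesgueRn := caratheodory_type lebesgue_outer.

HB.instance Definition _ := Measurable.on lebesgueRn.

Definition lebesgue : set lebesgueRn -> \bar R := lebesgue_outer.

HB.instance Definition _ := isMeasure.Build _ lebesgueRn R lebesgue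
  (@caratheodory_measure0 _ _ lebesgue_outer)
  (@caratheodory_measure_ge0 _ _ lebesgue_outer)
  (@caratheodory_measure_sigma_additive _ _ lebesgue_outer).

(* The points of R^n with the Borel sigma-algebra. *)
Definition borelRn := g_sigma_algebraType (@open 'rV[R]_n).

HB.instance Definition _ := Measurable.on borelRn.

End lebesgue_Rn.

Arguments lebesgue R n : clear implicits.

Section function_classes.
Context (R : realType) (n : nat).
Implicit Types (f g : 'rV[R]_n -> R) (X : set 'rV[R]_n).

Definition enorm (x : 'rV[R]_n) : R := Num.sqrt (\sum_i x 0 i ^+ 2).

Definition lebesgue_measurable f : Prop :=
  measurable_fun [set: lebesgueRn R n] f.

(* Measurability with respect to the completion of the Borel sigma-algebra
   under nu. *)
Definition completion_measurable (nu : set (borelRn R n) -> \bar R) f : Prop :=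
  forall B : set R, measurable B -> completed_algebra_gen nu (f @^-1` B).

(* Measurability is stated explicitly since the library integral is total: for
   a nonmeasurable nonnegative function it is a lower integral. *)
Definition pdf f : Prop :=
  [/\ lebesgue_measurable f, forall x, 0 <= f x &
      (\int[lebesgue R n]_x (f x)%:E)%E = 1%E].

(* For p = +oo this is the essential supremum of |1_X f|. *)
Definition Lp_norm X (p : \bar R) f : \bar R :=
  'N[lebesgue R n]_p[(EFin \o f) \_ X]%E.

Definition classCb f : Prop :=
  continuous f /\ (Lp_norm [set: 'rV[R]_n] +oo f < +oo)%E.

Definition classC0 f : Prop :=
  continuous f /\ forall e : R, 0 < e ->
    exists2 K : set 'rV[R]_n, compact K & (Lp_norm (~` K) +oo f < e%:E)%E.

Definition classV f : Prop :=
  classC0 f /\ exists beta theta : R, [/\ 0 < beta, 0 < theta &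
    forall x, `|f x| <= beta * (1 + enorm x) `^ (- n%:R - theta)].

Definition simplex m : set 'cV[R]_m :=
  [set c | \sum_i c i 0 = 1 /\ forall i, 0 <= c i 0].

Definition mixtures m g : set ('rV[R]_n -> R) :=
  [set h | exists (c : 'cV[R]_m) (mu : 'I_m -> 'rV[R]_n) (sigma : 'I_m -> R),
    [/\ simplex c, forall i, 0 < sigma i &
        h = fun x => \sum_i c i 0 * ((sigma i ^+ n)^-1 *
                       g ((sigma i)^-1 *: (x - mu i)))]].

(* Sequences are indexed by m >= 1; the value h 0 is irrelevant. *)
Definition mixture_seq g (h : nat -> 'rV[R]_n -> R) : Prop :=
  forall m, (0 < m)%N -> mixtures m g (h m).

End function_classes.

(* Main.v *)
From HB Require Import structures.
Require Import Defs.
From mathcomp Require Import all_boot all_order all_algebra.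
From mathcomp Require Import all_classical all_reals all_analysis.
From mathcomp Require Import measurable_realfun.
From mathcomp Require Import lra ring.

Set Implicit Arguments.
Unset Strict Implicit.
Unset Printing Implicit Defensive.
Import Order.TTheory GRing.Theory Num.Theory.
Import numFieldNormedType.Exports.
Local Open Scope classical_set_scope.
Local Open Scope ring_scope.

(** The core is the case of a continuous target [phi >= 0] with compact support
    and integral at most 1, which mixtures of [g] approximate uniformly
    ([approx_compact_support]).  The mixture is a Riemann sum for the
    convolution of [phi] with a narrow rescaling of [g].  Cut the support of
    [phi] into the cubes [Q i] of a fine grid, let [a i] be slightly below the
    values of [phi] on [Q i], and put at the centre of [Q i] a component of
    scale [s] and weight [a i * |Q i|].  At a point [x] it contributes
    [a i * g (z i) * |C i|], where [C i] is the cube of all [z] such that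
    [x - s z] lies in [Q i] and [z i] is the centre of [C i].  In the variable
    [z] the mixture is thus a Riemann sum for the integral of
    [phi (x - s z) * g z], which is close to [phi x] for small [s] because [g]
    has integral 1.  The errors are bounded by the moduli of continuity of
    [phi] and [g], both uniformly continuous because they vanish at infinity,
    and by the tail of the integral of [g].  About Lebesgue measure, this uses
    only its behaviour on cubes under scaling and translation.  The weight that
    is missing to reach 1 goes to one component spread out so much that it is
    uniformly small ([mixture_complete]); this is where the dimension has to be
    positive.

    The constraint that the integral be at most 1 survives every reduction to
    the core.  For uniform approximation, [f] is multiplied by a plateau
    function with values in [0, 1].  For convergence almost everywhere with
    respect to [nu], a completion-measurable [f] has a Borel minorant that is
    equal to it almost everywhere ([completion_minorant]); Lusin's theorem,
    applied to the sum of [nu] and Lebesgue measure on bounded regions, gives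
    continuous functions that converge to it [nu]-almost everywhere and whose
    Lebesgue integrals exceed 1 by so little that they can be rescaled
    ([compact_approx], [approx_ae_borel]).  Lebesgue measure itself is the case
    where [nu] is its restriction to Borel sets, since every Lebesgue measurable
    set is Borel up to a null set ([lebesgue_completion]).

    For [p > 1], truncation and Lusin's theorem reduce [f] to the core in the
    p-th mean, and there [|phi - h|^p] is at most the (p-1)-th power of the
    uniform error times [|phi - h|], whose integral is at most 2
    ([uniform_Lp_close]).  For [p = 1], mixtures of [g] have integral 1
    ([mixture_pdf]), so almost everywhere convergence implies convergence in L1
    by Scheffe's lemma ([scheffe]). *)

(** * Lebesgue outer measure under affine maps, and half-open boxes *)

Section LebesgueRn.
Context (R : realType) (n : nat).
Implicit Types (a b t : 'rV[R]_n) (X : set 'rV[R]_n).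

Lemma esumZl_le (T : choiceType) (D : set T) (f : T -> \bar R) (c : R) :
  0 <= c -> (forall k, 0 <= f k)%E ->
  (\esum_(k in D) (c%:E * f k) <= c%:E * \esum_(k in D) f k)%E.
Proof.
move=> c0 f0; apply: ge_ereal_sup => _ [A [finA AD] <-].
rewrite -ge0_mule_fsumr// lee_wpmul2l// ?lee_fin//.
by apply: esum_ge; exists A.
Qed.

Lemma ocbox_volume_affine (s : R) a b t : 0 < s ->
  ocbox_volume (s *: a + t) (s *: b + t) = s ^+ n * ocbox_volume a b.
Proof.
move=> s0; rewrite /ocbox_volume -[n in s ^+ n]card_ord -prodr_const -big_split/=.
apply: eq_bigr => i _.
by rewrite !mxE opprD addrACA subrr addr0 -mulrBr maxr_pMr ?(ltW s0)// mulr0.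
Qed.

Lemma ocbox_affine (s : R) a b t : 0 < s ->
  ocbox (s *: a + t) (s *: b + t) = [set x | ocbox a b (s^-1 *: (x - t))].
Proof.
move=> s0; apply/seteqP; split => x /= xab i; have := xab i; rewrite !mxE;
  by rewrite -ltrBrDr -lerBlDr ltr_pdivlMl// ler_pdivrMl.
Qed.

(** An affine map sends covers by boxes to covers by boxes, and multiplies
    their total volume. *)
Lemma lebesgue_outer_affine_le (s : R) t X : 0 < s ->
  (lebesgue_outer [set x | X (s^-1 *: (x - t))%R]
     <= (s ^+ n)%:E * lebesgue_outer X)%E.
Proof.
move=> s0; have sn0 : 0 < s ^+ n by rewrite exprn_gt0.
rewrite -lee_pdivrMl//; apply: le_ereal_inf_tmp => _ [D [a [b [XD ->]]]].
rewrite lee_pdivrMl//; apply: le_trans (esumZl_le _ (ltW sn0) _); last first.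
  by move=> k; rewrite lee_fin ocbox_volume_ge0.
apply: ereal_inf_lbound.
exists D, (fun k => s *: a k + t), (fun k => s *: b k + t); split.
  by move=> x /XD [k Dk xk]; exists k => //; rewrite ocbox_affine.
by apply: eq_esum => k _; rewrite ocbox_volume_affine// EFinM.
Qed.

(** The inequality for the inverse affine map gives the reverse one. *)
Lemma lebesgue_outer_affine (s : R) t X : 0 < s ->
  (lebesgue_outer [set x | X (s^-1 *: (x - t))%R]
     = (s ^+ n)%:E * lebesgue_outer X)%E.
Proof.
move=> s0; apply/eqP; rewrite eq_le lebesgue_outer_affine_le//=.
have sn0 : 0 < s ^+ n by rewrite exprn_gt0.
have V0 : 0 < s^-1 by rewrite invr_gt0.
have /= := @lebesgue_outer_affine_le s^-1 (- (s^-1 *: t))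
  [set x | X (s^-1 *: (x - t))%R] V0.
rewrite invrK exprVn muleC lee_pdivlMr// muleC; apply: le_trans.
have xE x : s^-1 *: (s *: (x - - (s^-1 *: t)) - t) = x.
  rewrite opprK [s *: _]scalerDr !scalerA mulfV ?gt_eqF// scale1r addrK.
  by rewrite scalerA mulVf ?gt_eqF// scale1r.
rewrite le_eqVlt; apply/orP; left; apply/eqP; congr (_ * lebesgue_outer _)%E.
by apply/seteqP; split => x /=; rewrite xE.
Qed.

Lemma lebesgue_outer_ocbox_lty a b : (lebesgue_outer (ocbox a b) < +oo)%E.
Proof.
apply: (@le_lt_trans _ _ (ocbox_volume a b)%:E); last exact: ltry.
apply: ereal_inf_lbound; exists [set 0%N], (fun=> a), (fun=> b); split.
  by move=> x abx; exists 0%N.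
by rewrite esum_set1// lee_fin ocbox_volume_ge0.
Qed.

Let row_set a i (r : R) : 'rV[R]_n := \row_j if j == i then r else a 0 j.

(** A coordinate hyperplane cuts a half-open box into two half-open boxes whose
    volumes add up, so it splits every cover without changing its total
    volume. *)
Lemma halfspace_measurable (i : 'I_n) (r : R) :
  measurable ([set x | x 0 i <= r] : set (lebesgueRn R n)).
Proof.
apply: le_caratheodory_measurable => X.
apply: le_ereal_inf_tmp => _ [D [a [b [XD ->]]]].
pose bl k := row_set (b k) i (Num.min (b k 0 i) r).
pose ar k := row_set (a k) i (Num.max (a k 0 i) r).
have volE k : (ocbox_volume (a k) (b k))%:E =
    ((ocbox_volume (a k) (bl k))%:E + (ocbox_volume (ar k) (b k))%:E)%E.
  pose V (a b : 'rV[R]_n) := \prod_(j | j != i) Num.max 0 (b 0 j - a 0 j).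
  have volD a' b' : ocbox_volume a' b' = Num.max 0 (b' 0 i - a' 0 i) * V a' b'.
    by rewrite /ocbox_volume (bigD1 i).
  have Vl : V (a k) (bl k) = V (a k) (b k).
    by apply: eq_bigr => j ji; rewrite !mxE (negbTE ji).
  have Vr : V (ar k) (b k) = V (a k) (b k).
    by apply: eq_bigr => j ji; rewrite !mxE (negbTE ji).
  rewrite -EFinD !volD Vl Vr !mxE eqxx -mulrDl; congr (_ * _)%:E.
  by rewrite /Num.max /Num.min; repeat case: ifPn; rewrite -?leNgt; lra.
under eq_esum do rewrite volE.
rewrite esumD; [|by move=> k _; rewrite lee_fin ocbox_volume_ge0..].
apply: leeD; apply: ereal_inf_lbound.
  exists D, a, bl; split=> // x [/XD [k Dk xk] /= xr]; exists k => // j.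
  rewrite mxE; case: eqP => [->|_]; last exact: xk.
  by have /andP[-> xb] := xk i; rewrite le_min xb.
exists D, ar, b; split=> // x [/XD [k Dk xk] /= /negP xr]; exists k => // j.
rewrite mxE; case: eqP => [->|_]; last exact: xk.
by have /andP[xa ->] := xk i; rewrite gt_max xa ltNge xr.
Qed.

Lemma ocbox_measurable a b : measurable (ocbox a b : set (lebesgueRn R n)).
Proof.
rewrite (_ : ocbox a b = \bigcap_(i in [set` enum 'I_n])
    (~` [set x | x 0 i <= a 0 i] `&` [set x | x 0 i <= b 0 i])).
  rewrite bigcap_seq; elim/big_ind: _ => [|A B|i _]; first exact: measurableT.
    exact: measurableI.
  apply: measurableI.
    by apply: measurableC; exact: halfspace_measurable.
  exact: halfspace_measurable.
apply/seteqP; split => x.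
  move=> abx i _; have /andP[ai bi] := abx i; split => //=.
  by apply/negP; rewrite -ltNge.
move=> abx i; have [|/= /negP] := abx i _; rewrite /= ?mem_enum//.
by rewrite -ltNge => -> ->.
Qed.

End LebesgueRn.

(** * Borel sets and Lebesgue measurable sets *)

Section BorelLebesgue.
Context (R : realType) (n : nat).
Implicit Types (a b t x y : 'rV[R]_n) (X : set 'rV[R]_n) (r e : R).

Lemma rV_norm_le x r : 0 <= r -> (`|x| <= r) <-> (forall i, `|x 0 i| <= r).
Proof.
move=> r0; rewrite [`|x|]/Num.Def.normr/= mx_normrE; split => [xr i|xr].
  exact: le_trans (le_bigmax 0 (fun ij => `|x ij.1 ij.2|) (0, i)) xr.
by apply/bigmax_leP; split => // -[i j] _ /=; rewrite (ord1 i).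
Qed.

(** Cubes have the half-open shape of the boxes that define the outer measure,
    so that translates of them tile the space. *)
Definition cube x r : set 'rV[R]_n := ocbox (x - const_mx r) (x + const_mx r).

Lemma cubeP x y r : cube x r y <-> forall i, x 0 i - r < y 0 i <= x 0 i + r.
Proof. by rewrite /cube /ocbox /=; split => xy i; have := xy i; rewrite !mxE. Qed.

Lemma cube_norm x y r : 0 <= r -> cube x r y -> `|x - y| <= r.
Proof.
move=> r0 /cubeP xy; apply/rV_norm_le => // i; rewrite !mxE ler_norml.
by have := xy i; lra.
Qed.

Lemma norm_cube x y r : `|x - y| < r -> cube x r y.
Proof.
move=> xyr; apply/cubeP => i.
have /(_ i) : forall i, `|(x - y) 0 i| <= `|x - y| by exact/rV_norm_le.
by rewrite !mxE => /le_lt_trans/(_ xyr); rewrite ltr_norml; lra.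
Qed.

Lemma open_cube X x : open X -> X x ->
  exists2 e : R, 0 < e & forall y, `|x - y| < e -> X y.
Proof.
move=> oX Xx; have /nbhs_ballP[e /= e0 xeX] : nbhs x X by exact: open_nbhs_nbhs.
by exists e => // y xy; apply: xeX; rewrite -ball_normE.
Qed.

Lemma natSinv_lt e : 0 < e -> exists k : nat, k.+1%:R^-1 < e.
Proof.
move=> e0; have [k _ /(_ _ (leqnn k)) ke] := near_infty_natSinv_lt (PosNum e0).
by exists k.
Qed.

Lemma rat_approx x e : 0 < e ->
  exists q : 'rV[rat]_n, `|x - map_mx ratr q| <= e.
Proof.
move=> e0.
have /choice[q qP] (i : 'I_n) : exists q : rat, ratr q \in `]x 0 i - e, x 0 i + e[.
  by apply: rat_in_itvoo; lra.
exists (\row_i q i); apply/rV_norm_le; first exact: ltW.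
by move=> i; rewrite !mxE ler_norml; have := qP i; rewrite in_itv/=; lra.
Qed.

(** An open set is the union of the cubes that it contains, among those of
    rational centre and radius of the form 1/(k+1). *)
Lemma open_lebesgue_measurable X : open X -> measurable (X : set (lebesgueRn R n)).
Proof.
move=> oX.
pose c (u : 'rV[rat]_n * nat) := cube (map_mx ratr u.1) (u.2.+1%:R^-1 : R).
pose F u := if pselect (c u `<=` X) is left _ then c u else set0.
rewrite (_ : X = \bigcup_u F u); last first.
  apply/seteqP; split => [x Xx|x [u _]]; last first.
    by rewrite /F; case: pselect => // + cx; exact.
  have [e e0 xeX] := open_cube oX Xx.
  have [k ke] : exists k : nat, (k.+1%:R^-1 : R) < e / 2.
    by apply: natSinv_lt; rewrite divr_gt0.
  have k0 : 0 < (k.+1%:R^-1 : R) by rewrite invr_gt0.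
  have [|q qx] := @rat_approx x (k.+1%:R^-1 / 2); first by rewrite divr_gt0.
  exists (q, k) => //; rewrite /F; case: pselect => [_|[]].
    apply: norm_cube; rewrite distrC (le_lt_trans qx)//=.
    by rewrite ltr_pdivrMr// ltr_pMr// ltr1n.
  move=> y /cube_norm /= qy; apply: xeX.
  rewrite -(subrKA (map_mx ratr q)) (le_lt_trans (ler_normD _ _))//.
  have ek : e / 2 + e / 2 <= e by lra.
  apply: lt_le_trans ek; apply: ler_ltD.
    apply: le_trans qx _; apply: le_trans (ltW ke).
    by rewrite ler_pdivrMr// ler_pMr// ler1n.
  exact: le_lt_trans (qy (ltW k0)) ke.
apply: countable_bigcupT_measurable => [|u].
  exact: (@countableP ('rV[rat]_n * nat)%type).
by rewrite /F; case: pselect => _; [exact: ocbox_measurable|exact: measurable0].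
Qed.

Lemma borel_lebesgue_measurable (B : set (borelRn R n)) :
  measurable B -> measurable (B : set (lebesgueRn R n)).
Proof.
move: B; apply: smallest_sub; last by move=> A; exact: open_lebesgue_measurable.
exact: (@sigma_algebra_measurable _ (lebesgueRn R n)).
Qed.

Lemma ocbox_borel a b : measurable (ocbox a b : set (borelRn R n)).
Proof.
have half (i : 'I_n) r : measurable ([set x | r < x 0 i] : set (borelRn R n)).
  apply: sub_sigma_algebra.
  apply: (@open_comp _ _ (fun x : 'rV[R]_n => x 0 i) [set y | r < y]).
    by move=> x _; exact: coord_continuous.
  exact: open_gt.
rewrite (_ : ocbox a b = \bigcap_(i in [set` enum 'I_n])
    ([set x | a 0 i < x 0 i] `&` ~` [set x | b 0 i < x 0 i])).
  rewrite bigcap_seq; elim/big_ind: _ => [|A B|i _]; first exact: measurableT.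
    exact: measurableI.
  by apply: measurableI; [exact: half|apply: measurableC; exact: half].
apply/seteqP; split => x.
  move=> abx i _; have /andP[ai bi] := abx i; split => //=.
  by apply/negP; rewrite -leNgt.
move=> abx i; have [|/= -> /negP] := abx i _; rewrite /= ?mem_enum//.
by rewrite -leNgt.
Qed.

(** Lebesgue measure as a measure on the Borel sigma-algebra, the form in which
    it is an instance of the measures [nu] on [borelRn]. *)
Definition lebesgue_borel : set (borelRn R n) -> \bar R := @lebesgue_outer R n.

Let lebesgue_borel0 : lebesgue_borel set0 = 0%E.
Proof. exact: lebesgue_outer0. Qed.

Let lebesgue_borel_ge0 A : (0 <= lebesgue_borel A)%E.
Proof. exact: lebesgue_outer_ge0. Qed.

Let lebesgue_borel_sigma_additive : semi_sigma_additive lebesgue_borel.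
Proof.
move=> F mF tF mU.
apply: (@measure_semi_sigma_additive _ _ _ (lebesgue R n)) => //.
  by move=> i; exact: borel_lebesgue_measurable.
exact: borel_lebesgue_measurable.
Qed.

HB.instance Definition _ := isMeasure.Build _ _ _ lebesgue_borel
  lebesgue_borel0 lebesgue_borel_ge0 lebesgue_borel_sigma_additive.

Lemma cubes_cover : \bigcup_k cube 0 k.+1%:R = [set: 'rV[R]_n].
Proof.
apply/seteqP; split => // x _; exists (Num.truncn `|x|) => //.
by apply: norm_cube; rewrite sub0r normrN truncnS_gt.
Qed.

Lemma lebesgue_borel_sigma_finite : sigma_finite setT lebesgue_borel.
Proof.
exists (fun k => cube 0 k.+1%:R); first by rewrite cubes_cover.
by move=> k; split; [exact: ocbox_borel|exact: lebesgue_outer_ocbox_lty].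
Qed.

HB.instance Definition _ := @Measure_isSigmaFinite.Build _ _ _ lebesgue_borel
  lebesgue_borel_sigma_finite.

End BorelLebesgue.

(** * Integrals under affine maps, null open sets and completion *)

Section LebesgueIntegral.
Context (R : realType) (n : nat).
Implicit Types (a b t x y : 'rV[R]_n) (X : set 'rV[R]_n) (r e s : R).
Local Notation lam := (lebesgue R n).

(** The Riemann sums below measure cubes through this homogeneity, with the
    measure of the unit cube as a normalizing constant. *)
Lemma lebesgue_cube x r : 0 < r ->
  lam (cube x r) = ((r ^+ n)%:E * lam (cube 0%R 1))%E.
Proof.
move=> r0; rewrite /lebesgue -(lebesgue_outer_affine x)//.
congr (lebesgue_outer _); rewrite /= -ocbox_affine// /cube.
by congr (ocbox _ _); apply/rowP => i; rewrite !mxE; ring.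
Qed.

Lemma lebesgue_measurableP (A : set (lebesgueRn R n)) :
  measurable A <-> caratheodory_measurable (@lebesgue_outer R n) A.
Proof. by []. Qed.

Lemma affine_measurable s t : 0 < s ->
  measurable_fun [set: lebesgueRn R n]
    ((fun x => s^-1 *: (x - t)) : lebesgueRn R n -> lebesgueRn R n).
Proof.
move=> s0 _ Y /lebesgue_measurableP mY; rewrite setTI.
apply/lebesgue_measurableP => X.
have s'0 : 0 < s^-1 by rewrite invr_gt0.
have xE x : s^-1 *: (s *: x + t - t) = x.
  by rewrite addrK scalerA mulVf ?gt_eqF// scale1r.
have XE : X = [set x | [set y | X (s *: y + t)] (s^-1 *: (x - t))].
  apply/seteqP; split => x /=; rewrite scalerA mulfV ?gt_eqF// scale1r subrK//.
rewrite {1}XE lebesgue_outer_affine// (mY [set y | X (s *: y + t)]).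
rewrite ge0_muleDr ?lebesgue_outer_ge0// -!(lebesgue_outer_affine t)//.
have IE Z : [set x | ([set y | X (s *: y + t)] `&` Z) (s^-1 *: (x - t))] =
    X `&` ((fun x => s^-1 *: (x - t)) @^-1` Z) by rewrite {2}XE.
by rewrite !IE.
Qed.

Lemma integral_affine s t (u : 'rV[R]_n -> \bar R) : 0 < s ->
  measurable_fun [set: lebesgueRn R n] u -> (forall x, 0 <= u x)%E ->
  (\int[lam]_x u (s^-1 *: (x - t)) = (s ^+ n)%:E * \int[lam]_x u x)%E.
Proof.
move=> s0 mu u0; have sn0 : 0 <= s ^+ n by rewrite exprn_ge0// ltW.
have := @ge0_integral_pushforward _ _ _ _ R _ (affine_measurable t s0) lam setT u
  measurableT mu (fun x _ => u0 x).
rewrite preimage_setT => <-.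
rewrite -[s ^+ n]/(NngNum sn0)%:num -ge0_integral_mscale//.
apply: eq_measure_integral => [|mphi A mA _]; first exact: affine_measurable.
exact: lebesgue_outer_affine.
Qed.

(** If the unit cube were null, then all cubes and hence the whole space would
    be, and no function could have integral 1. *)
Lemma pdf_cube_gt0 (f : 'rV[R]_n -> R) : pdf f -> (0 < lam (cube 0%R 1))%E.
Proof.
move=> [mf f0 f1]; rewrite lt0e lebesgue_outer_ge0 andbT; apply/eqP => c0.
have ck k : lam (cube 0%R k.+1%:R) = 0%E by rewrite lebesgue_cube// c0 mule0.
have lamT : lam setT = 0%E.
  apply/negligibleP; first exact: measurableT.
  rewrite -(cubes_cover R n); apply: negligible_bigcup => k.
  apply/negligibleP; first exact: ocbox_measurable.
  exact: ck.
have := @null_set_integral _ _ _ lam setT (EFin \o f) measurableT.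
rewrite f1 => /(_ _ lamT) f10.
by have /eqP := f10 (proj2 (measurable_EFinP _ _) mf); rewrite onee_eq0.
Qed.

(** A nonempty open set contains a cube, and the measures of all cubes are
    positive multiples of that of the unit cube. *)
Lemma open_null (f : 'rV[R]_n -> R) X : pdf f -> open X -> lam X = 0%E -> X = set0.
Proof.
move=> pf oX X0; apply/seteqP; split => // x Xx.
have [e e0 xeX] := open_cube oX Xx.
have e2 : 0 < e / 2 by rewrite divr_gt0.
have cX : cube x (e / 2) `<=` X.
  by move=> y /(cube_norm (ltW e2)) xy; apply: xeX; lra.
have := le_lebesgue_outer cX; rewrite [X in (_ <= X)%E -> _]X0.
rewrite leNgt -/(lam _) => /negP[]; rewrite lebesgue_cube// mule_gt0//.
  by rewrite lte_fin exprn_gt0.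
exact: pdf_cube_gt0 pf.
Qed.

(** The intersection of a sequence of countable unions of boxes, whose outer
    measures tend to that of [X]. *)
Lemma lebesgue_outer_borel X : exists G : set (borelRn R n),
  [/\ measurable G, X `<=` G & lebesgue_outer G = lebesgue_outer X].
Proof.
have [Xoo|Xfin] := eqVneq (lebesgue_outer X) +oo%E.
  exists setT; split => //; apply/eqP; rewrite eq_le Xoo leey/= -Xoo.
  exact: le_lebesgue_outer.
have /choice[G GP] (m : nat) : exists G : set (borelRn R n), [/\ measurable G,
    X `<=` G & (lebesgue_outer G <= lebesgue_outer X + (m.+1%:R^-1)%:E)%E].
  have Xf : lebesgue_outer X \is a fin_num.
    by rewrite ge0_fin_numE ?lebesgue_outer_ge0// ltey.
  have m0 : 0 < (m.+1%:R^-1 : R) by rewrite invr_gt0.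
  have [_ [D [a [b [XD ->]]]] slt] := lb_ereal_inf_adherent m0 Xf.
  exists (\bigcup_(k in D) ocbox (a k) (b k)); split => //.
    by apply: bigcup_measurable => k _; exact: ocbox_borel.
  by apply: le_trans (ltW slt); apply: ereal_inf_lbound; exists D, a, b; split.
exists (\bigcap_m G m); split.
- by apply: bigcap_measurable => // m _; have [] := GP m.
- by move=> x Xx m _; have [_ + _] := GP m; exact.
- apply/eqP; rewrite eq_le; apply/andP; split; last first.
    by apply: le_lebesgue_outer => x Xx m _; have [_ + _] := GP m; exact.
  apply/lee_addgt0Pr => e /natSinv_lt[m me].
  have [_ _ Gm] := GP m; apply: (@le_trans _ _ (lebesgue_outer (G m))).
    by apply: le_lebesgue_outer; exact: bigcap_inf.
  by apply: (le_trans Gm); rewrite leeD2l// lee_fin ltW.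
Qed.

(** Within each cube, the complement of a Borel hull of the complement of [A]
    is a Borel subset of [A] of full measure. *)
Lemma lebesgue_completion (A : set (lebesgueRn R n)) : measurable A ->
  completed_algebra_gen (@lebesgue_borel R n) A.
Proof.
move=> mA; pose C k : set 'rV[R]_n := cube 0 k.+1%:R.
have mC k : measurable (C k : set (lebesgueRn R n)) by exact: ocbox_measurable.
have /choice[G GP] (k : nat) := lebesgue_outer_borel (C k `\` A).
pose B := \bigcup_k (C k `\` G k).
have BA : B `<=` A.
  move=> x [k _ [Ckx nGx]]; apply: contrapT => nAx.
  by apply: nGx; have [_ + _] := GP k; apply.
have AB0 : lam (A `\` B) = 0%E.
  have mG k : measurable (G k : set (lebesgueRn R n)).
    by apply: borel_lebesgue_measurable; have [] := GP k.
  have mB : measurable (B : set (lebesgueRn R n)).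
    by apply: bigcup_measurable => k _; exact: measurableD.
  apply/negligibleP; first exact: measurableD.
  suff : lam.-negligible (\bigcup_k (G k `\` (C k `\` A))).
    apply: negligibleS => x [Ax nBx].
    have [k _ Ckx] : (\bigcup_k C k) x by rewrite cubes_cover.
    exists k => //; split => [|[]//]; apply: contrapT => nGx.
    by apply: nBx; exists k.
  apply: negligible_bigcup => k; apply/negligibleP.
    by apply: measurableD => //; exact: measurableD.
  have [_ CG GC] := GP k.
  have mCA : measurable (C k `\` A : set (lebesgueRn R n)) by exact: measurableD.
  have Cf : (lam (C k `\` A) < +oo)%E.
    apply: le_lt_trans (lebesgue_outer_ocbox_lty _ _).
    by apply: le_lebesgue_outer => x [+ _]; exact.
  have GC' : lam (G k) = lam (C k `\` A) by exact: GC.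
  have Gf : (lam (G k) < +oo)%E by rewrite GC'.
  rewrite (measureD _ _ Gf)// (_ : G k `&` _ = C k `\` A); last first.
    by apply/seteqP; split => [x []//|x Cx]; split => //; exact: CG.
  rewrite -[X in (X - _)%E]/(lam (G k)) GC'.
  by rewrite subee// ge0_fin_numE// lebesgue_outer_ge0.
have [N [mN ABN N0]] := lebesgue_outer_borel (A `\` B).
exists B => /=.
  apply: bigcup_measurable => k _; apply: measurableD.
    exact: ocbox_borel.
  by have [] := GP k.
exists (A `\` B); last exact: setDUK.
exists N; split => //; rewrite -[RHS]AB0; exact: N0.
Qed.

End LebesgueIntegral.

(** * Continuous functions vanishing at infinity *)

Section ContinuousFunctions.
Context (R : realType) (n : nat).
Implicit Types (x y : 'rV[R]_n) (X : set 'rV[R]_n) (r e : R) (u : 'rV[R]_n -> R).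
Local Notation lam := (lebesgue R n).

Lemma continuous_borel_measurable u : continuous u ->
  measurable_fun [set: borelRn R n] u.
Proof.
move=> cu; apply: (measurability _ (RGenOInfty.measurableE R)).
move=> _ [_ [r ->] <-]; rewrite setTI; apply: sub_sigma_algebra.
apply: open_comp; first by move=> x _; exact: cu.
by rewrite set_itvE; exact: open_gt.
Qed.

Lemma borel_lebesgue_measurable_fun u :
  measurable_fun [set: borelRn R n] u -> lebesgue_measurable u.
Proof.
move=> mu _ B mB; apply: borel_lebesgue_measurable.
by have := mu measurableT B mB.
Qed.

Lemma continuous_lebesgue_measurable u : continuous u -> lebesgue_measurable u.
Proof.
move=> cu; apply: borel_lebesgue_measurable_fun.
exact: continuous_borel_measurable.
Qed.

Definition vanishing u := forall e, 0 < e ->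
  exists r, forall x, r < `|x| -> `|u x| <= e.

Lemma compact_norm_ball r : compact [set x : 'rV[R]_n | `|x| <= r].
Proof.
apply: bounded_closed_compact; last first.
  apply: (@closed_comp _ _ (fun x : 'rV[R]_n => `|x|) [set s | s <= r]).
    by move=> x _; exact: norm_continuous.
  exact: closed_le.
exists r; split; first exact: num_real.
by move=> s rs x /= xr; rewrite (le_trans xr)// ltW.
Qed.

(** Off a compact set the bound given by the essential supremum holds almost
    everywhere, hence everywhere, because the set where a continuous function
    violates it is open. *)
Lemma classC0_vanishing (f u : 'rV[R]_n -> R) : pdf f -> classC0 u -> vanishing u.
Proof.
move=> pf [cu C0u] e e0; have [K cK] := C0u e e0.
have T0 : (0 < lam setT)%E.
  by apply: lt_le_trans (pdf_cube_gt0 pf) _; exact: le_lebesgue_outer.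
rewrite /Lp_norm unlock /Lnorm T0.
move=> /ltW /ess_sup_inf.ess_supP [N [mN N0 NP]].
have [r [_ rK]] := compact_bounded cK.
exists (r + 1) => x rx; rewrite leNgt; apply/negP => ux.
have : [set y | ~ K y /\ e < `|u y|] = set0.
  apply: (open_null pf).
    apply: openI; first by apply: closed_openC; exact: compact_closed.
    apply: (@open_comp _ _ (fun y => `|u y|) [set s | e < s]); last exact: open_gt.
    by move=> y _; apply: continuous_comp; [exact: cu|exact: norm_continuous].
  apply/eqP; rewrite eq_le lebesgue_outer_ge0 andbT -[leRHS]N0.
  apply: le_lebesgue_outer => y [nKy uy]; apply: NP => /=.
  by rewrite patchE mem_set//= lee_fin => /(lt_le_trans uy); rewrite ltxx.
move/seteqP => [/(_ x) + _]; apply; split => // Kx.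
have r1 : r < r + 1 by rewrite ltrDl.
by have /= := rK (r + 1) r1 x Kx; rewrite leNgt rx.
Qed.

(** Near infinity both values are small; elsewhere [x] stays in a closed ball,
    which is compact. The ball is larger by 1 than the region where [u] may be
    large, and [d <= 1], so that the two cases cover everything. *)
Lemma vanishing_unif_continuous u : continuous u -> vanishing u ->
  forall e, 0 < e ->
  exists2 d : R, 0 < d & forall x y, `|x - y| <= d -> `|u x - u y| <= e.
Proof.
move=> cu vu e e0; have e20 : 0 < e / 2 by rewrite divr_gt0.
have [r ru] := vu _ e20.
have /compact_near_coveringP cB := @compact_norm_ball (r + 1).
have /= H := cB R 0^'+ (fun d x => forall y, `|x - y| <= d -> `|u x - u y| <= e) _.
have /H[] : forall x, `|x| <= r + 1 -> \forall x' \near x & d \near 0^'+,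
    forall y, `|x' - y| <= d -> `|u x' - u y| <= e.
  move=> x _.
  have /cvgr_dist_le /(_ _ e20) /nbhs_ballP[d /= d0 dP] := cu x.
  have d20 : 0 < d / 2 by rewrite divr_gt0.
  exists (ball x (d / 2), [set s | s < d / 2]).
    by split => /=; [exact: nbhsx_ballx|exact: nbhs_right_lt].
  move=> [y s] /= [xy sd] z yz.
  have uy : `|u x - u y| <= e / 2.
    by apply: dP; apply: le_ball xy; lra.
  have uz : `|u x - u z| <= e / 2.
    apply: dP; move: xy; rewrite -!ball_normE /= => xy.
    by rewrite -(subrKA y) (le_lt_trans (ler_normD _ _))//; lra.
  by rewrite -(subrKA (u x)) (le_trans (ler_normD _ _))// distrC; lra.
move=> d /= d0 dP; exists (Num.min (d / 2) 1).
  by rewrite lt_min ltr01 divr_gt0.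
move=> x y; rewrite le_min => /andP[xyd xy1].
have [xr|xr] := leP `|x| (r + 1).
  apply: (dP (d / 2)) => //=; last by rewrite divr_gt0.
  by rewrite sub0r normrN gtr0_norm ?divr_gt0//; lra.
have yr : r < `|y|.
  have := ler_normD (x - y) y; rewrite subrK; lra.
have := ru x _; have := ru y yr; have := ler_normB (u x) (u y).
by move=> ? ? /(_ _); lra.
Qed.

Lemma vanishing_bounded u : continuous u -> vanishing u ->
  exists2 M : R, 0 < M & forall x, `|u x| <= M.
Proof.
move=> cu vu; have [r ru] := vu _ ltr01.
have cB : compact (u @` [set x | `|x| <= r]).
  apply: continuous_compact; last exact: compact_norm_ball.
  exact: continuous_subspaceT.
have [M [_ MP]] := compact_bounded cB.
exists (`|M| + 1); first by rewrite ltr_wpDl.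
move=> x; have [xr|xr] := leP `|x| r.
  by apply: (MP (`|M| + 1)); [rewrite (le_lt_trans (ler_norm _))// ltrDl|exists x].
by rewrite (le_trans (ru _ xr))// lerDr.
Qed.

(** A piecewise linear plateau, falling from 1 to 0 between the spheres of
    radius [r] and [r + 1]. *)
Definition cutoff r x : R := Num.max 0 (Num.min 1 (r + 1 - `|x|)).

Lemma cutoff_ge0 r x : 0 <= cutoff r x.
Proof. by rewrite le_max lexx. Qed.

Lemma cutoff_le1 r x : cutoff r x <= 1.
Proof. by rewrite ge_max ler01 ge_min lexx. Qed.

Lemma cutoff_in r x : `|x| <= r -> cutoff r x = 1.
Proof. by move=> xr; rewrite /cutoff min_l ?max_r//; lra. Qed.

Lemma cutoff_out r x : r + 1 <= `|x| -> cutoff r x = 0.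
Proof. by move=> xr; rewrite /cutoff max_l// ge_min subr_le0 xr orbT. Qed.

Lemma cutoff_continuous r : continuous (cutoff r).
Proof.
move=> x; apply: (@continuous_max _ _ (cst 0) (fun x => Num.min 1 (r + 1 - `|x|))).
  exact: cst_continuous.
apply: (@continuous_min _ _ (cst 1) (fun x => (r + 1 - `|x|))).
  exact: cst_continuous.
apply: continuousB; first exact: cst_continuous.
exact: norm_continuous.
Qed.

Lemma compact_support_vanishing u r :
  (forall x, r <= `|x| -> u x = 0) -> vanishing u.
Proof. by move=> ur e e0; exists r => x rx; rewrite ur ?normr0// ltW. Qed.

End ContinuousFunctions.

(** * Integrals of nonnegative functions, and finite mixtures *)

Section MeasureGeneral.
Context d (T : measurableType d) (R : realType) (mu : {measure set T -> \bar R}).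

Lemma ge0_integral_realD (u v : T -> R) :
  measurable_fun setT u -> measurable_fun setT v ->
  (forall x, 0 <= u x) -> (forall x, 0 <= v x) ->
  (\int[mu]_x (u x + v x)%:E = \int[mu]_x (u x)%:E + \int[mu]_x (v x)%:E)%E.
Proof.
move=> mu' mv u0 v0; under eq_integral do rewrite EFinD.
by apply: ge0_integralD => //;
  [move=> x _; rewrite lee_fin|exact/measurable_EFinP
  |move=> x _; rewrite lee_fin|exact/measurable_EFinP].
Qed.

Lemma ge0_integral_realZ (k : R) (u : T -> R) :
  measurable_fun setT u -> 0 <= k -> (forall x, 0 <= u x) ->
  (\int[mu]_x (k * u x)%:E = k%:E * \int[mu]_x (u x)%:E)%E.
Proof.
move=> mu' k0 u0; under eq_integral do rewrite EFinM.
by apply: ge0_integralZl_EFin => //;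
  [move=> x _; rewrite lee_fin|exact/measurable_EFinP].
Qed.

Lemma ge0_integral_real_lin3 (a b c : R) (u v w : T -> R) :
  measurable_fun setT u -> measurable_fun setT v -> measurable_fun setT w ->
  0 <= a -> 0 <= b -> 0 <= c ->
  (forall x, 0 <= u x) -> (forall x, 0 <= v x) -> (forall x, 0 <= w x) ->
  (\int[mu]_x (a * u x + b * v x + c * w x)%:E =
   a%:E * \int[mu]_x (u x)%:E + b%:E * \int[mu]_x (v x)%:E +
   c%:E * \int[mu]_x (w x)%:E)%E.
Proof.
move=> mu' mv mw a0 b0 c0 u0 v0 w0.
have mM k (h : T -> R) : measurable_fun setT h ->
  measurable_fun setT (fun x => k * h x) by move=> mh; exact: measurable_funM.
rewrite !ge0_integral_realD.
- by rewrite !ge0_integral_realZ.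
- exact: mM.
- exact: mM.
- by move=> x; rewrite mulr_ge0.
- by move=> x; rewrite mulr_ge0.
- by apply: measurable_funD; exact: mM.
- exact: mM.
- by move=> x; rewrite addr_ge0// mulr_ge0.
- by move=> x; rewrite mulr_ge0.
Qed.

Lemma ge0_le_integral_real (u v : T -> R) :
  measurable_fun setT u -> measurable_fun setT v ->
  (forall x, 0 <= u x) -> (forall x, u x <= v x) ->
  (\int[mu]_x (u x)%:E <= \int[mu]_x (v x)%:E)%E.
Proof.
move=> mu' mv u0 uv; apply: ge0_le_integral => //.
- by move=> x _; rewrite lee_fin.
- exact/measurable_EFinP.
- exact/measurable_EFinP.
- by move=> x _; rewrite lee_fin.
Qed.

(** For nonnegative functions the comparison of integrals splits into two
    inequalities between integrals in the extended reals, so no integrability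
    has to be checked. *)
Lemma ge0_integral_close (U V E : T -> R) (u v e : R) :
  measurable_fun setT U -> measurable_fun setT V -> measurable_fun setT E ->
  (forall x, 0 <= U x) -> (forall x, 0 <= V x) ->
  (forall x, `|U x - V x| <= E x) ->
  (\int[mu]_x (U x)%:E = u%:E)%E -> (\int[mu]_x (V x)%:E = v%:E)%E ->
  (\int[mu]_x (E x)%:E <= e%:E)%E -> `|u - v| <= e.
Proof.
move=> mU mV mE U0 V0 UVE iU iV iE.
have E0 x : 0 <= E x by apply: le_trans (UVE x).
have half (F G : T -> R) (a b : R) :
    measurable_fun setT F -> measurable_fun setT G ->
    (forall x, 0 <= F x) -> (forall x, 0 <= G x) -> (forall x, F x <= G x + E x) ->
    (\int[mu]_x (F x)%:E = a%:E)%E -> (\int[mu]_x (G x)%:E = b%:E)%E -> a <= b + e.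
  move=> mF mG F0 G0 FGE iF iG; rewrite -lee_fin EFinD -iF -iG.
  apply: (@le_trans _ _ (\int[mu]_x (G x + E x)%:E)%E).
    by apply: ge0_le_integral_real => //; exact: measurable_funD.
  by rewrite ge0_integral_realD// leeD2l.
have uv : u <= v + e.
  by apply: (half U V) => // x; have := UVE x; rewrite ler_norml; lra.
have vu : v <= u + e.
  by apply: (half V U) => // x; have := UVE x; rewrite ler_norml; lra.
by rewrite ler_norml; lra.
Qed.

Lemma measurable_sum_indic (I : finType) (b : I -> R) (A : I -> set T) :
  (forall i, measurable (A i)) ->
  measurable_fun setT (fun x => \sum_i b i * \1_(A i) x).
Proof.
by move=> mA; apply: measurable_sum => i; apply: measurable_funM.
Qed.

Lemma integral_sum_indic (I : finType) (b : I -> R) (A : I -> set T) :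
  (forall i, measurable (A i)) -> (forall i, 0 <= b i) ->
  (\int[mu]_x (\sum_i b i * \1_(A i) x)%:E = \sum_i (b i)%:E * mu (A i))%E.
Proof.
move=> mA b0; under eq_integral do rewrite -sumEFin.
rewrite ge0_integral_sum//.
- apply: eq_bigr => i _.
  by rewrite ge0_integral_realZ// integral_indic ?setIT.
- by move=> i; apply/measurable_EFinP/measurable_funM.
- by move=> i x _; rewrite lee_fin mulr_ge0.
Qed.

Lemma ge0_integral_le_indic2 (a b c : R) (u v : T -> R) (A B : set T) :
  measurable_fun setT u -> measurable_fun setT v -> measurable A -> measurable B ->
  0 <= a -> 0 <= b -> 0 <= c -> (forall x, 0 <= u x) -> (forall x, 0 <= v x) ->
  (forall x, v x <= a * u x + b * \1_A x + c * \1_B x) ->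
  (\int[mu]_x (v x)%:E <=
    a%:E * \int[mu]_x (u x)%:E + b%:E * mu A + c%:E * mu B)%E.
Proof.
move=> mu' mv mA mB a0 b0 c0 u0 v0 vle.
have m1 (C : set T) : measurable C -> measurable_fun setT (\1_C : T -> R).
  by move=> mC; exact: measurable_indic.
have mM k (h : T -> R) : measurable_fun setT h ->
  measurable_fun setT (fun x => k * h x) by move=> mh; exact: measurable_funM.
apply: (@le_trans _ _ (\int[mu]_x (a * u x + b * \1_A x + c * \1_B x)%:E)%E).
  apply: ge0_le_integral_real => //.
  by do ?[apply: measurable_funD]; apply: mM => //; exact: m1.
rewrite ge0_integral_real_lin3//.
by rewrite !integral_indic// !setIT.
Qed.

End MeasureGeneral.

Lemma sum_indic_eq (R : realType) (T : Type) (I : finType) (b : I -> R)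
    (A : I -> set T) x i :
  (forall j, A j x -> j = i) -> A i x -> \sum_j b j * \1_(A j) x = b i.
Proof.
move=> uA Aix; rewrite (bigD1 i)//= indicE mem_set// mulr1 big1 ?addr0// => j ji.
by rewrite indicE memNset ?mulr0// => /uA ij; rewrite ij eqxx in ji.
Qed.

Lemma sum_indic0 (R : realType) (T : Type) (I : finType) (b : I -> R)
    (A : I -> set T) x :
  (forall j, ~ A j x) -> \sum_j b j * \1_(A j) x = 0.
Proof. by move=> nA; rewrite big1// => j _; rewrite indicE memNset ?mulr0. Qed.

Section Mixtures.
Context (R : realType) (n : nat) (g : 'rV[R]_n -> R).

Definition component (s : R) (mu x : 'rV[R]_n) : R :=
  (s ^+ n)^-1 * g (s^-1 *: (x - mu)).

(** Components may be indexed by any finite type, which avoids arithmetic on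
    indices when mixtures are put together. *)
Lemma mixtures_fin (I : finType) (p : I -> R) (mu : I -> 'rV[R]_n) (s : I -> R) :
  \sum_i p i = 1 -> (forall i, 0 <= p i) -> (forall i, 0 < s i) ->
  mixtures #|I| g (fun x => \sum_i p i * component (s i) (mu i) x).
Proof.
move=> p1 p0 s0.
exists (\col_k p (enum_val k)), (fun k => mu (enum_val k)).
exists (fun k => s (enum_val k)).
have reI (F : I -> R) : \sum_(k < #|I|) F (enum_val k) = \sum_i F i.
  by rewrite [RHS](reindex _ (onW_bij _ (@enum_val_bij I))).
split; [split=> [|k]|by []|].
- by under eq_bigr do rewrite mxE; rewrite reI.
- by rewrite mxE.
- apply/funext => x; under [RHS]eq_bigr do rewrite mxE.
  by rewrite -(reI (fun i => p i * component (s i) (mu i) x)).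
Qed.

(** Components of weight 0 are added. *)
Lemma mixtures_widen m k h : mixtures m g h -> mixtures (m + k) g h.
Proof.
move=> [c [mu [s [[c1 c0] s0 ->]]]].
pose p (u : 'I_m + 'I_k) := if u is inl i then c i 0 else 0.
pose mu' (u : 'I_m + 'I_k) := if u is inl i then mu i else 0.
pose s' (u : 'I_m + 'I_k) := if u is inl i then s i else 1.
have := @mixtures_fin ('I_m + 'I_k)%type p mu' s'.
rewrite card_sum !card_ord (_ : (fun x => _) = (fun x => \sum_i c i 0 *
    ((s i ^+ n)^-1 * g ((s i)^-1 *: (x - mu i))))); last first.
  apply/funext => x; rewrite big_sumType/= [X in _ + X]big1 ?addr0// => i _.
  by rewrite mul0r.
apply.
- by rewrite big_sumType/= [X in _ + X]big1 ?addr0.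
- by move=> [].
- by move=> [].
Qed.

(** A finite family of weights of total at most 1 is completed by one component
    so spread out that it is uniformly small. *)
Lemma mixture_complete (I : finType) (p : I -> R) (mu : I -> 'rV[R]_n)
    (s M e : R) :
  (0 < n)%N -> 0 < s -> (forall i, 0 <= p i) -> \sum_i p i <= 1 ->
  0 < M -> (forall x, `|g x| <= M) -> 0 < e ->
  exists2 h, mixtures #|I|.+1 g h &
    forall x, `|h x - \sum_i p i * component s (mu i) x| <= e.
Proof.
(* [M / t <= e], and [1 <= t] ensures [t <= t ^ n] as [0 < n]. *)
move=> n0 s0 p0 p1 M0 gM e0; pose t := M / e + 1.
have t1 : 1 <= t by rewrite lerDr ltW// divr_gt0.
have t0 : 0 < t by exact: lt_le_trans t1.
pose p' (u : I + unit) := if u is inl i then p i else 1 - \sum_i p i.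
pose mu' (u : I + unit) := if u is inl i then mu i else 0.
pose s' (u : I + unit) := if u is inl i then s else t.
exists (fun x => \sum_u p' u * component (s' u) (mu' u) x).
  have := @mixtures_fin (I + unit)%type p' mu' s'.
  rewrite card_sum card_unit addn1; apply.
  - by rewrite big_sumType/= big_const card_unit /= addr0 addrC subrK.
  - by move=> [i|_] //=; rewrite subr_ge0.
  - by move=> [].
move=> x; rewrite big_sumType/= big_const card_unit /= addr0.
rewrite [_ + _ - _]addrAC subrr add0r.
have p2 : 0 <= \sum_i p i by exact: sumr_ge0.
rewrite normrM ger0_norm ?subr_ge0//.
apply: (@le_trans _ _ (1 * (t^-1 * M))); last first.
  rewrite mul1r mulrC ler_pdivrMr// /t mulrDr mulr1 mulrCA divff ?gt_eqF//.
  by rewrite mulr1 lerDl ltW.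
apply: ler_pM => //; first by rewrite subr_ge0.
  by rewrite gerBl.
have tn0 : 0 < t ^+ n by exact: exprn_gt0.
rewrite /component normrM ler_pM// gtr0_norm ?invr_gt0//.
by rewrite lef_pV2 ?posrE// ler_eXnr.
Qed.

End Mixtures.

(** * Grids of cubes, and tails of integrals *)

Section ERealSequences.
Context (R : realType).
Implicit Types (u : nat -> \bar R) (e : R).

Lemma cvge0_near_le u : u @ \oo --> 0%E ->
  forall e, 0 < e -> \forall k \near \oo, (u k <= e%:E)%E.
Proof.
move=> /fine_cvgP[ufin u0] e e0; near=> k.
rewrite -[u k]fineK; last by near: k.
by rewrite lee_fin; near: k; exact: (cvgr_le _ u0).
Unshelve. all: by end_near. Qed.

Lemma ge0_near_le_cvge0 u : (forall k, (0 <= u k)%E) ->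
  (forall e, 0 < e -> \forall k \near \oo, (u k <= e%:E)%E) -> u @ \oo --> 0%E.
Proof.
move=> u0 ue; have ufin : \forall k \near \oo, u k \is a fin_num.
  have := ue 1 ltr01; apply: filterS => k uk.
  by rewrite ge0_fin_numE// (le_lt_trans uk)// ltry.
apply/fine_cvgP; split => //; apply/cvgrPdist_le => e e0; near=> k.
rewrite sub0r normrN /= ger0_norm ?fine_ge0// -lee_fin fineK; last by near: k.
by near: k; exact: ue.
Unshelve. all: by end_near. Qed.

End ERealSequences.

Section Grid.
Context (R : realType) (n : nat).
Implicit Types (x y z c : 'rV[R]_n) (d s : R).

Definition cocube c d : set 'rV[R]_n :=
  [set y | forall j, c 0 j - d <= y 0 j < c 0 j + d].

(** The change of variable [y = x - s z] reverses the coordinates, and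
    therefore exchanges the two kinds of half-open cubes. *)
Lemma cube_cocube s x c d z : 0 < s ->
  cube (s^-1 *: (x - c)) (s^-1 * d) z <-> cocube c d (x - s *: z).
Proof.
move=> s0; rewrite cubeP /cocube /=; split => + j => /(_ j);
  rewrite !mxE -mulrBr -mulrDr ltr_pdivrMl// ler_pdivlMl//; lra.
Qed.

Lemma cocube_norm c d y : 0 <= d -> cocube c d y -> `|c - y| <= d.
Proof.
move=> d0 cy; apply/rV_norm_le => // j; rewrite !mxE ler_norml.
by have := cy j; lra.
Qed.

Definition grid_point N d (i : {ffun 'I_n -> 'I_N}) : 'rV[R]_n :=
  \row_j ((2 * (i j)%:R + 1 - N%:R) * d).

Let step N d (k l : nat) : 0 < d -> (k < l)%N ->
  (2 * k%:R + 1 - N%:R) * d + d <= (2 * l%:R + 1 - N%:R) * d - d :> R.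
Proof.
move=> d0 kl; have : (k.+1%:R <= l%:R :> R) by rewrite ler_nat.
rewrite -(ler_pM2r d0) -natr1; lra.
Qed.

Lemma grid_cube_inj N d (i i' : {ffun 'I_n -> 'I_N}) y : 0 < d ->
  cube (grid_point d i) d y -> cube (grid_point d i') d y -> i = i'.
Proof.
move=> d0 /cubeP iy /cubeP iy'; apply/ffunP => j; apply/val_inj.
have := iy j; have := iy' j; rewrite !mxE.
by case: (ltngtP (i j) (i' j)) => // /(@step N _ _ _ d0) ? ? ?; exfalso; lra.
Qed.

Lemma grid_cocube_inj N d (i i' : {ffun 'I_n -> 'I_N}) y : 0 < d ->
  cocube (grid_point d i) d y -> cocube (grid_point d i') d y -> i = i'.
Proof.
move=> d0 iy iy'; apply/ffunP => j; apply/val_inj.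
have := iy j; have := iy' j; rewrite !mxE.
by case: (ltngtP (i j) (i' j)) => // /(@step N _ _ _ d0) ? ? ?; exfalso; lra.
Qed.

(** The index of the cube containing [y] is read off by truncating the
    coordinates in units of the side [2 * d]. *)
Lemma grid_cocube_cover N d y : 0 < d -> `|y| < N%:R * d ->
  exists i : {ffun 'I_n -> 'I_N}, cocube (grid_point d i) d y.
Proof.
move=> d0 yN.
have yj j : `|y 0 j| < N%:R * d.
  apply: le_lt_trans yN; move: j; apply/rV_norm_le => //.
pose t j := (y 0 j / d + N%:R) / 2.
have tE j : y 0 j = (2 * t j - N%:R) * d.
  by rewrite /t mulrCA divff// mulr1 addrK divfK ?gt_eqF.
have t0 j : 0 <= t j.
  have := yj j; rewrite ltr_norml tE => /andP[+ _].
  rewrite -mulNr ltr_pM2r//; lra.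
have tN j : (Num.trunc (t j) < N)%N.
  rewrite truncn_lt_nat//; have := yj j; rewrite ltr_norml tE => /andP[_].
  rewrite ltr_pM2r//; lra.
exists [ffun j => Ordinal (tN j)] => j; rewrite !mxE ffunE /= tE.
have /andP[k1 k2] := truncn_itv (t0 j).
move: k1 k2; rewrite -(ler_pM2r d0) -(ltr_pM2r d0) -natr1; lra.
Qed.

End Grid.

Section Tail.
Context (R : realType) (n : nat) (g : 'rV[R]_n -> R).

Lemma pdf_tail e : pdf g -> 0 < e -> exists2 r : R, 0 < r &
  (\int[lebesgue R n]_x (g x * \1_(~` cube 0%R r) x)%:E <= e%:E)%E.
Proof.
move=> [mg g0 g1] e0.
pose G k x := (g x * \1_(~` cube 0%R k.+1%:R) x)%:E.
have mG k : measurable_fun [set: lebesgueRn R n] (G k).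
  apply/measurable_EFinP/measurable_funM => //.
  by apply: measurable_indic; apply: measurableC; exact: ocbox_measurable.
have [|||_ _] := @dominated_convergence _ _ _ (lebesgue R n) setT measurableT
  G (cst 0%E) (EFin \o g) mG (measurable_cst _).
- apply: nearW => x _; apply: cvg_near_cst.
  have [k _ xk] : (\bigcup_k cube 0 k.+1%:R) x by rewrite cubes_cover.
  exists k => // l kl; rewrite /G indicE memNset ?mulr0//; apply.
  move/cubeP: xk => xk; apply/cubeP => i; have := xk i.
  have : (k.+1%:R <= l.+1%:R :> R) by rewrite ler_nat ltnS.
  by rewrite !mxE; lra.
- apply/integrableP; split; first exact/measurable_EFinP.
  under eq_integral do rewrite /= ger0_norm//.
  by rewrite g1 ltry.
- apply: nearW => x k _; rewrite /G /= lee_fin ger0_norm ?mulr_ge0//.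
  by rewrite ler_piMr// indicE; case: (_ \in _).
rewrite integral0 => /cvge0_near_le /(_ _ e0)[k _ /(_ k (leqnn k)) Ge].
by exists k.+1%:R.
Qed.

End Tail.

(** * Uniform approximation of compactly supported functions *)

Section Core.
Context (R : realType) (n : nat) (g : 'rV[R]_n -> R).
Hypotheses (n_gt0 : (0 < n)%N) (pdf_g : pdf g).
Hypotheses (cg : continuous g) (vg : vanishing g).
Local Notation lam := (lebesgue R n).

Let kappa : R := fine (lam (cube 0%R 1)).

Let kappa_ge0 : 0 <= kappa.
Proof. by rewrite fine_ge0// lebesgue_outer_ge0. Qed.

Let lam_cube x r : 0 < r -> lam (cube x r) = (r ^+ n * kappa)%:E.
Proof.
move=> r0; rewrite lebesgue_cube// EFinM fineK// ge0_fin_numE.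
  exact: lebesgue_outer_ocbox_lty.
exact: lebesgue_outer_ge0.
Qed.

Let mcube x r : measurable (cube x r : set (lebesgueRn R n)).
Proof. exact: ocbox_measurable. Qed.

(** The coefficients are the values of [phi] at the grid points lowered by its
    oscillation [w]. So the step function stays below [phi], which bounds the
    total weight by the integral of [phi], and is within [2 * w] of [phi]. The
    first fact is needed on [cube]s, whose measure is known, the second one on
    the reflected [cocube]s that appear after the change of variable. *)
Lemma compact_support_step (phi : 'rV[R]_n -> R) (w d r : R) :
  (forall x, 0 <= phi x) -> (forall x, r <= `|x| -> phi x = 0) ->
  (\int[lam]_x (phi x)%:E <= 1)%E -> continuous phi -> 0 < d ->
  (forall x y, `|x - y| <= d -> `|phi x - phi y| <= w) ->
  exists (N : nat) (a : {ffun 'I_n -> 'I_N} -> R), [/\ forall i, 0 <= a i,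
    \sum_i a i * (d ^+ n * kappa) <= 1 &
    forall y, `|\sum_i a i * \1_(cocube (grid_point d i) d) y - phi y| <= 2 * w].
Proof.
move=> phi0 phir phi1 cphi d0 phid.
have w0 : 0 <= w.
  by have := phid 0 0; rewrite !subrr !normr0; apply; exact: ltW.
pose N := (Num.trunc (r / d)).+1.
have Nr : r < N%:R * d by rewrite -ltr_pdivrMr// truncnS_gt.
pose a (i : {ffun 'I_n -> 'I_N}) := Num.max 0 (phi (grid_point d i) - w).
have a0 i : 0 <= a i by rewrite le_max lexx.
have aphi i y : `|grid_point d i - y| <= d -> phi y - 2 * w <= a i <= phi y.
  move=> /phid; rewrite ler_norml => /andP[h1 h2].
  by rewrite le_max ge_max phi0; apply/andP; split; [apply/orP; right|]; lra.
exists N, a; split => //.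
  rewrite -lee_fin -sumEFin (le_trans _ phi1)//.
  under eq_bigr => i _ do rewrite EFinM -(lam_cube (grid_point d i) d0).
  rewrite -(@integral_sum_indic _ _ _ lam)//.
  apply: (@ge0_le_integral _ _ _ lam setT measurableT).
  - by move=> x _; rewrite lee_fin sumr_ge0// => i _; rewrite mulr_ge0.
  - by apply/measurable_EFinP/measurable_sum_indic => i; exact: mcube.
  - by apply/measurable_EFinP; exact: continuous_lebesgue_measurable.
  - move=> x _; rewrite lee_fin.
    have [[i ix]|nx] :=
        pselect (exists i : {ffun 'I_n -> 'I_N}, cube (grid_point d i) d x).
      rewrite (sum_indic_eq a (i := i))//.
        by have /andP[] := aphi i x (cube_norm (ltW d0) ix).
      by move=> j jx; exact: grid_cube_inj d0 jx ix.
    by rewrite sum_indic0// => j jx; apply: nx; exists j.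
move=> y; have [[i iy]|ny] :=
    pselect (exists i : {ffun 'I_n -> 'I_N}, cocube (grid_point d i) d y).
  rewrite (sum_indic_eq a (i := i))//.
    have /andP[] := aphi i y (cocube_norm (ltW d0) iy).
    by rewrite ler_norml; lra.
  by move=> j jy; exact: grid_cocube_inj d0 jy iy.
rewrite sum_indic0; last by move=> j jy; apply: ny; exists j.
rewrite phir ?subr0 ?normr0 ?mulr_ge0//.
rewrite leNgt; apply/negP => yr; apply: ny; apply: grid_cocube_cover => //.
exact: lt_trans Nr.
Qed.

Lemma approx_compact_support (phi : 'rV[R]_n -> R) (r e : R) :
  continuous phi -> (forall x, 0 <= phi x) -> (forall x, r <= `|x| -> phi x = 0) ->
  (\int[lam]_x (phi x)%:E <= 1)%E -> 0 < e ->
  exists m h, [/\ (0 < m)%N, mixtures m g h & forall x, `|phi x - h x| <= e].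
Proof.
move=> cphi phi0 phir phi1 e0.
have [mg g0 g1] := pdf_g.
(* One sixth for the leftover component, five for the Riemann sum. *)
pose w : R := e / 6; have w0 : 0 < w by rewrite divr_gt0.
have vphi := compact_support_vanishing phir.
have [d0 d00 phid0] := vanishing_unif_continuous cphi vphi w0.
have [M M0 phiM] := vanishing_bounded cphi vphi.
have [G G0 gG] := vanishing_bounded cg vg.
have [rho rho0 tail] := pdf_tail pdf_g (divr_gt0 w0 M0).
pose s : R := d0 / rho; have s0 : 0 < s by rewrite divr_gt0.
have sn0 : 0 < s ^+ n by rewrite exprn_gt0.
(* The scale [s] is fixed first, so that the oscillation of [g] can be made
   small relative to the height [s ^- n] of the components. *)
have [d1 d10 gd1] := vanishing_unif_continuous cg vg (mulr_gt0 w0 sn0).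
pose d : R := Num.min d0 (s * d1).
have dp : 0 < d by rewrite lt_min d00 mulr_gt0.
have phid x y : `|x - y| <= d -> `|phi x - phi y| <= w.
  by rewrite le_min => /andP[+ _]; exact: phid0.
have [N [a [a0 a1 aphi]]] := compact_support_step phi0 phir phi1 cphi dp phid.
pose p i := a i * (d ^+ n * kappa).
pose c (i : {ffun 'I_n -> 'I_N}) := grid_point d i : 'rV[R]_n.
have p0 i : 0 <= p i by rewrite mulr_ge0// mulr_ge0// exprn_ge0// ltW.
have [h hm hP] := mixture_complete (g := g) c n_gt0 s0 p0 a1 G0 gG w0.
exists #|{ffun 'I_n -> 'I_N}|.+1, h; split => // x.
suff hx : `|\sum_i p i * component g s (c i) x - phi x| <= 5 * w.
  rewrite distrC -(subrKA (\sum_i p i * component g s (c i) x)).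
  rewrite (le_trans (ler_normD _ _))// (le_trans (lerD (hP x) hx))// /w; lra.
pose z i := s^-1 *: (x - c i); pose C i := cube (z i) (s^-1 * d).
have sd0 : 0 < s^-1 * d by rewrite mulr_gt0// invr_gt0.
have lamC i : lam (C i) = (s ^- n * (d ^+ n * kappa))%:E.
  by rewrite lam_cube// exprMn exprVn mulrA.
(* The step function seen from [x]: close to [y |-> phi (x - s y)]. *)
pose st y := \sum_i a i * \1_(C i) y.
have stE y : st y = \sum_i a i * \1_(cocube (c i) d) (x - s *: y).
  apply: eq_bigr => i _; congr (_ * _); rewrite !indicE.
  suff -> : (y \in C i) = (x - s *: y \in cocube (c i) d) by [].
  by apply/idP/idP; rewrite !inE => /(cube_cocube x (c i) d y s0).
pose U y := \sum_i (a i * g (z i)) * \1_(C i) y.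
pose V y := phi x * g y.
pose E y := 3 * w * g y + M * (g y * \1_(~` cube 0 rho) y) + w * s ^+ n * st y.
have mst : measurable_fun [set: lebesgueRn R n] st.
  by apply: measurable_sum_indic => i; exact: mcube.
have mtail : measurable_fun [set: lebesgueRn R n]
    (fun y => g y * \1_(~` cube 0 rho) y).
  apply: measurable_funM => //; apply: measurable_indic.
  by apply: measurableC; exact: mcube.
have st0 y : 0 <= st y by apply: sumr_ge0 => i _; rewrite mulr_ge0.
have ag0 i : 0 <= a i * g (z i) by rewrite mulr_ge0.
apply: (@ge0_integral_close _ _ _ lam U V E).
- by apply: measurable_sum_indic => i; exact: mcube.
- exact: measurable_funM.
- by apply: measurable_funD; [apply: measurable_funD|]; exact: measurable_funM.
- by move=> y; apply: sumr_ge0 => i _; rewrite mulr_ge0.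
- by move=> y; rewrite mulr_ge0.
- move=> y.
  have UE : `|U y - st y * g y| <= w * s ^+ n * st y.
    rewrite /U /st mulr_suml -sumrB mulr_sumr (le_trans (ler_norm_sum _ _ _))//.
    apply: ler_sum => i _; rewrite indicE; case: (boolP (y \in C i)) => yC.
      rewrite !mulr1 -mulrBr normrM ger0_norm// mulrC ler_wpM2r//.
      apply: gd1; have := cube_norm (ltW sd0) (set_mem yC) => /le_trans; apply.
      by rewrite ler_pdivrMl// ge_min lexx orbT.
    by rewrite !mulr0 mul0r subrr normr0.
  have stphi := aphi (x - s *: y); rewrite -stE in stphi.
  (* For [y] in the central cube, [s *: y] has norm at most [d0]. *)
  have phiE : `|phi (x - s *: y) - phi x| <= w + M * \1_(~` cube 0 rho) y.
    rewrite indicE in_setC; case: (boolP (y \in cube 0 rho)) => yC /=.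
      rewrite mulr0 addr0; apply: phid0.
      rewrite addrAC subrr add0r normrN normrZ gtr0_norm//.
      have := cube_norm (ltW rho0) (set_mem yC); rewrite sub0r normrN => yr.
      by rewrite (le_trans (ler_wpM2l (ltW s0) yr))// divfK ?gt_eqF.
    have := phiM x; have := phiM (x - s *: y); rewrite mulr1 !(ger0_norm (phi0 _)).
    by have := phi0 x; have := phi0 (x - s *: y); rewrite ler_norml; lra.
  have stx : `|st y * g y - V y| <= (3 * w + M * \1_(~` cube 0 rho) y) * g y.
    rewrite -mulrBl normrM (ger0_norm (g0 y)) ler_wpM2r//.
    rewrite -(subrKA (phi (x - s *: y))) (le_trans (ler_normD _ _))//; lra.
  rewrite -(subrKA (st y * g y)) (le_trans (ler_normD _ _))//.
  apply: le_trans (lerD UE stx) _; rewrite /E le_eqVlt; apply/orP; left; apply/eqP.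
  by ring.
- transitivity (\sum_i (a i * g (z i))%:E * lam (C i))%E.
    by apply: integral_sum_indic => // i; exact: mcube.
  under eq_bigr do rewrite lamC -EFinM.
  rewrite sumEFin; congr EFin; apply: eq_bigr => i _.
  by rewrite /component /p /z; ring.
- rewrite -[RHS]mule1 -g1.
  by apply: (@ge0_integral_realZ _ _ _ lam) => //; exact: phi0.
- have w3 : 0 <= 3 * w by rewrite mulr_ge0// ltW.
  have ws : 0 <= w * s ^+ n by rewrite mulr_ge0// ltW.
  have t0 y : 0 <= g y * \1_(~` cube 0 rho) y by rewrite mulr_ge0.
  have -> : (\int[lam]_y (E y)%:E = (3 * w)%:E * \int[lam]_y (g y)%:E +
      M%:E * \int[lam]_y (g y * \1_(~` cube 0 rho) y)%:E +
      (w * s ^+ n)%:E * \int[lam]_y (st y)%:E)%E.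
    by apply: ge0_integral_real_lin3 => //; exact: ltW.
  have -> : (\int[lam]_y (st y)%:E = \sum_i (a i)%:E * lam (C i))%E.
    by apply: integral_sum_indic => // i; exact: mcube.
  rewrite g1 mule1.
  under eq_bigr do rewrite lamC -EFinM.
  rewrite sumEFin.
  have -> : \sum_i a i * (s ^- n * (d ^+ n * kappa)) = s ^- n * \sum_i p i.
    by rewrite mulr_sumr; apply: eq_bigr => i _; rewrite mulrCA.
  have tM : (M%:E * \int[lam]_y (g y * \1_(~` cube 0 rho) y)%:E <= w%:E)%E.
    apply: le_trans (lee_wpmul2l _ tail) _; first by rewrite lee_fin ltW.
    by rewrite -EFinM mulrCA divff ?mulr1 ?gt_eqF.
  apply: le_trans (leeD (leeD (lexx _) tM) (lexx _)) _.
  rewrite -EFinM -!EFinD lee_fin.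
  have -> : w * s ^+ n * (s ^- n * \sum_i p i) = w * \sum_i p i.
    by rewrite mulrA mulfK ?gt_eqF.
  by have := ler_wpM2l (ltW w0) a1; rewrite mulr1 /p; lra.
Qed.

End Core.

(** * From approximations to sequences of mixtures *)

Section MixtureSequences.
Context (R : realType) (n : nat) (g : 'rV[R]_n -> R).
Local Notation lam := (lebesgue R n).

(** The [m]-th term is [H k] for the largest [k <= m] such that [H k] has at
    most [m] components, filled up with components of weight 0. *)
Lemma mixture_seq_reindex (H : nat -> 'rV[R]_n -> R) :
  (forall k, exists m, (0 < m)%N /\ mixtures m g (H k)) ->
  exists2 h, mixture_seq g h &
    exists K : nat -> nat, K @ \oo --> \oo /\ \forall m \near \oo, h m = H (K m).
Proof.
move=> /choice[M MP].
have /choice[kh khP] (m : nat) : exists kh : nat * ('rV[R]_n -> R),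
    ((0 < m)%N -> mixtures m g kh.2) /\
    (forall N, (maxn (M N) N <= m)%N -> kh.2 = H kh.1 /\ (N <= kh.1)%N).
  have [exN|nN] := pselect (exists N, (maxn (M N) N <= m)%N); last first.
    pose h : 'rV[R]_n -> R := fun x => \sum_(i : unit) 1 * component g 1 0 x.
    exists (0%N, h); split => [m0|N mN]; last by exfalso; apply: nN; exists N.
    have := @mixtures_fin _ _ g unit (fun=> 1) (fun=> 0) (fun=> 1).
    rewrite card_unit big_const card_unit /= addr0 => h1.
    by rewrite -(subnKC m0); apply: mixtures_widen; exact: h1.
  have ubm i : (maxn (M i) i <= m)%N -> (i <= m)%N by rewrite geq_max => /andP[].
  have [k km kmax] := ex_maxnP exN ubm.
  exists (k, H k); split => [_|N mN]; last by split => //; exact: kmax.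
  move: km; rewrite geq_max => /andP[+ _] => km.
  by rewrite -(subnKC km); apply: mixtures_widen; exact: (MP k).2.
exists (fun m => (kh m).2); first by move=> m m0; exact: (khP m).1.
exists (fun m => (kh m).1); split.
  move=> A [N _ NA]; exists (maxn (M N) N) => // m /= Nm; apply: NA => /=.
  by have [_] := (khP m).2 N Nm.
exists (maxn (M 0%N) 0) => // m /= Nm.
by have [] := (khP m).2 0%N Nm.
Qed.

Lemma mixture_seq_approx (D : ('rV[R]_n -> R) -> \bar R) :
  (forall h, (0 <= D h)%E) ->
  (forall e : R, 0 < e ->
    exists m h, [/\ (0 < m)%N, mixtures m g h & (D h <= e%:E)%E]) ->
  exists2 h, mixture_seq g h & D (h m) @[m --> \oo] --> 0%E.
Proof.
move=> D0 De.
have /choice[H HP] (k : nat) : exists h, (exists m, (0 < m)%N /\ mixtures m g h) /\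
    (D h <= (k.+1%:R^-1)%:E)%E.
  have [|m [h [m0 mh Dh]]] := De k.+1%:R^-1; first by rewrite invr_gt0.
  by exists h; split => //; exists m.
have [h hm [K [Koo hK]]] := mixture_seq_reindex (fun k => (HP k).1).
exists h => //.
have H0 : D (H k) @[k --> \oo] --> 0%E.
  apply: ge0_near_le_cvge0 => // e e0.
  have [N _ NP] := near_infty_natSinv_lt (PosNum e0).
  exists N => // k Nk; apply: le_trans (HP k).2 _.
  by rewrite lee_fin ltW//; exact: NP.
have HK0 : D (H (K m)) @[m --> \oo] --> 0%E.
  by have := @cvg_comp _ _ _ K (fun k => D (H k)) _ _ _ Koo H0; exact.
apply: cvg_trans HK0; apply: near_eq_cvg.
by apply: filterS hK => m ->.
Qed.

Lemma Lp_norm_ge0 X p (u : 'rV[R]_n -> R) : (0 <= Lp_norm X p u)%E.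
Proof. exact: Lnorm_ge0. Qed.

Lemma Lp_norm_oo_le X (u : 'rV[R]_n -> R) (e : R) : 0 <= e ->
  (forall x, X x -> `|u x| <= e) -> (Lp_norm X +oo u <= e%:E)%E.
Proof.
move=> e0 uX; rewrite /Lp_norm unlock /Lnorm; case: ifPn => // _.
apply/ess_sup_inf.ess_supP; apply: nearW => x /=; rewrite patchE.
case: ifPn => [/set_mem/uX|_]; first by rewrite /= lee_fin.
by rewrite [point](_ : _ = 0%E)// abse0 lee_fin.
Qed.

Hypotheses (n_gt0 : (0 < n)%N) (pdf_g : pdf g).
Hypotheses (cg : continuous g) (vg : vanishing g).

Lemma approx_cutoff (f : 'rV[R]_n -> R) (r e : R) : pdf f -> continuous f -> 0 < e ->
  exists m h, [/\ (0 < m)%N, mixtures m g h &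
    forall x, `|f x * cutoff r x - h x| <= e].
Proof.
move=> [mf f0 f1] cf e0; have cfr : continuous (fun x => f x * cutoff r x).
  by move=> x; apply: continuousM; [exact: cf|exact: cutoff_continuous].
have fr0 x : 0 <= f x * cutoff r x by rewrite mulr_ge0// cutoff_ge0.
apply: (approx_compact_support n_gt0 pdf_g cg vg (r := r + 1)) => //.
  by move=> x xr; rewrite cutoff_out ?mulr0.
have mfr := continuous_lebesgue_measurable cfr.
have frf x : f x * cutoff r x <= f x by rewrite ler_piMr// cutoff_le1.
by have := @ge0_le_integral_real _ _ _ lam _ f mfr mf fr0 frf; rewrite f1.
Qed.

(** Far away both [f] and its cut-off version are small. *)
Lemma approx_C0 (f : 'rV[R]_n -> R) : pdf f -> continuous f -> vanishing f ->
  exists2 h, mixture_seq g h &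
    Lp_norm [set: 'rV[R]_n] +oo (f \- h m) @[m --> \oo] --> 0%E.
Proof.
move=> pf cf vf.
apply: (mixture_seq_approx (D := fun h => Lp_norm setT +oo (f \- h))).
  by move=> h; exact: Lp_norm_ge0.
move=> e e0; have e20 : 0 < e / 2 by rewrite divr_gt0.
have [r fr] := vf _ e20; have [_ f0 _] := pf.
have [m [h [m0 mh hP]]] := approx_cutoff r pf cf e20.
exists m, h; split => //; apply: Lp_norm_oo_le => [|x _]; first exact: ltW.
suff : `|f x - f x * cutoff r x| <= e / 2.
  move=> ?; rewrite /= -(subrKA (f x * cutoff r x)) (le_trans (ler_normD _ _))//.
  by have := hP x; lra.
have [xr|xr] := leP `|x| r.
  by rewrite cutoff_in// mulr1 subrr normr0 ltW.
rewrite -{1}(mulr1 (f x)) -mulrBr normrM (le_trans _ (fr x xr))// ler_piMr//.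
by have := cutoff_ge0 r x; have := cutoff_le1 r x; rewrite ler_norml; lra.
Qed.

(** On a compact set the plateau makes no difference. *)
Lemma approx_compact (f : 'rV[R]_n -> R) (K : set 'rV[R]_n) :
  pdf f -> continuous f -> compact K -> exists2 h, mixture_seq g h &
    Lp_norm K +oo (f \- h m) @[m --> \oo] --> 0%E.
Proof.
move=> pf cf cK; apply: (mixture_seq_approx (D := fun h => Lp_norm K +oo (f \- h))).
  by move=> h; exact: Lp_norm_ge0.
move=> e e0; have [r [_ rK]] := compact_bounded cK.
have r1 : r < r + 1 by rewrite ltrDl.
have [m [h [m0 mh hP]]] := approx_cutoff (r + 1) pf cf e0.
exists m, h; split => //; apply: Lp_norm_oo_le => [|x Kx]; first exact: ltW.
by have := hP x; rewrite cutoff_in ?mulr1//; exact: (rK (r + 1) r1 x Kx).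
Qed.

End MixtureSequences.

(** * Lusin's theorem for finite Borel measures *)

Section Distance.
Context (R : realType) (n : nat).
Implicit Types (x : 'rV[R]_n) (X : set 'rV[R]_n).

(** The distance to the complement, or the constant 1 if the complement is
    empty. *)
Lemma open_distance X : open X -> exists dist : 'rV[R]_n -> R,
  [/\ continuous dist, forall x, 0 <= dist x, forall x, X x -> 0 < dist x &
      forall x, ~ X x -> dist x = 0].
Proof.
move=> oX; have [XT|/existsNP[a nXa]] := pselect (forall x, X x).
  exists (cst 1); split => //; first exact: cst_continuous.
pose D := @edist_inf R 'rV[R]_n (~` X).
have Dfin x : D x \is a fin_num.
  rewrite ge0_fin_numE ?edist_inf_ge0//.
  apply: (@le_lt_trans _ _ (edist (x, a))).
    by apply: ereal_inf_lbound; exists a.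
  rewrite -ge0_fin_numE ?edist_ge0//; apply/edist_finP => /=.
  by exists (`|x - a| + 1); rewrite ?ltr_wpDl// -ball_normE /= ltrDl.
exists (fine \o D); split.
- move=> x; apply: fine_cvg; first exact: nbhs_filter.
  rewrite fineK//; exact: edist_inf_continuous.
- by move=> x; rewrite fine_ge0// edist_inf_ge0.
- move=> x Xx /=; have [e e0 xeX] := open_cube oX Xx.
  apply: lt_le_trans e0 _; rewrite -lee_fin fineK//.
  apply: le_ereal_inf_tmp => _ [b nXb <-]; rewrite leNgt; apply/negP => xb.
  apply: nXb; apply: xeX; have := @edist_lt_ball _ _ _ (x, b) xb.
  by rewrite -ball_normE.
- by move=> x nXx /=; rewrite /D edist_inf0.
Qed.

End Distance.

Section Lusin.
Context (R : realType) (n : nat) (mu : {measure set (borelRn R n) -> \bar R}).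
Hypothesis mu_fin : (mu setT < +oo)%E.
Implicit Types (f : 'rV[R]_n -> R) (A B : set (borelRn R n)) (e : R).

(** Closeness is allowed to be inexact off [B], so that this class is closed
    under finite linear combinations and uniform limits. *)
Definition lusin f := forall e, 0 < e -> exists (psi : 'rV[R]_n -> R) B,
  [/\ continuous psi, measurable B, (mu B <= e%:E)%E &
      forall x, ~ B x -> `|f x - psi x| <= e].

Let mu_lty A : measurable A -> (mu A < +oo)%E.
Proof. by move=> mA; apply: le_lt_trans mu_fin; apply: le_measure; rewrite ?inE. Qed.

Lemma lusin_cst c : lusin (cst c).
Proof.
move=> e e0; exists (cst c), set0; split => //; first exact: cst_continuous.
  by rewrite measure0 lee_fin ltW.
by move=> x _; rewrite subrr normr0 ltW.
Qed.

Lemma lusinD f f' : lusin f -> lusin f' -> lusin (f \+ f').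
Proof.
move=> lf lf' e e0; have e20 : 0 < e / 2 by rewrite divr_gt0.
have [u [B [cu mB Be uP]]] := lf _ e20; have [v [C [cv mC Ce vP]]] := lf' _ e20.
exists (u \+ v), (B `|` C); split => //.
- by move=> x; apply: continuousD; [exact: cu|exact: cv].
- exact: measurableU.
- rewrite (le_trans (measureU2 _ _ _))// (splitr e) EFinD leeD//.
- move=> x /not_orP[nB nC] /=; have := uP x nB; have := vP x nC.
  by rewrite !ler_norml; lra.
Qed.

Lemma lusinZ c f : lusin f -> lusin (fun x => c * f x).
Proof.
move=> lf e e0; have c0 : 0 < `|c| + 1 by rewrite ltr_wpDl.
have d0 : 0 < e / (`|c| + 1) by rewrite divr_gt0.
have [u [B [cu mB Be uP]]] := lf _ d0.
exists (fun x => c * u x), B; split => //.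
- by move=> x; apply: continuousM; [exact: cst_continuous|exact: cu].
- by apply: le_trans Be _; rewrite lee_fin ler_pdivrMr// ler_pMr// lerDr.
- move=> x nB; rewrite -mulrBr normrM (le_trans (ler_wpM2l _ (uP x nB)))//.
  by rewrite mulrCA ger_pMr// ler_pdivrMr// mul1r lerDl.
Qed.

Lemma lusin_sum (I : Type) (s : seq I) (F : I -> 'rV[R]_n -> R) :
  (forall i, lusin (F i)) -> lusin (fun x => \sum_(i <- s) F i x).
Proof.
move=> lF; elim: s => [|i s IH].
  rewrite (_ : (fun x => _) = cst 0) ?funeqE => [|x]; first exact: lusin_cst.
  by rewrite big_nil.
rewrite (_ : (fun x => _) = F i \+ (fun x => \sum_(i <- s) F i x)).
  exact: lusinD.
by rewrite funeqE => x; rewrite big_cons.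
Qed.

Lemma lusin_unif f : (forall e, 0 < e -> exists2 f', lusin f' &
  forall x, `|f x - f' x| <= e) -> lusin f.
Proof.
move=> uf e e0; have e20 : 0 < e / 2 by rewrite divr_gt0.
have [f' lf' ff'] := uf _ e20; have [u [B [cu mB Be uP]]] := lf' _ e20.
exists u, B; split => //; first by apply: le_trans Be _; rewrite lee_fin; lra.
by move=> x nB; have := uP x nB; have := ff' x; rewrite !ler_norml; lra.
Qed.

(** For sets, the approximation is required to be exact off [B]; this makes the
    class stable under complements and unions. *)
Definition lusin_set A := measurable A /\ forall e, 0 < e ->
  exists (psi : 'rV[R]_n -> R) B,
  [/\ continuous psi, measurable B, (mu B <= e%:E)%E &
      forall x, ~ B x -> psi x = \1_A x].

Lemma lusin_setC A : lusin_set A -> lusin_set (~` A).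
Proof.
move=> [mA lA]; split; first exact: measurableC.
move=> e /lA[u [B [cu mB Be uP]]]; exists (fun x => 1 - u x), B; split => //.
  by move=> x; apply: continuousB; [exact: cst_continuous|exact: cu].
by move=> x nB; rewrite uP// !indicE in_setC; case: (_ \in _); rewrite ?subrr ?subr0.
Qed.

Lemma lusin_setU A B : lusin_set A -> lusin_set B -> lusin_set (A `|` B).
Proof.
move=> [mA lA] [mB lB]; split; first exact: measurableU.
move=> e e0; have e20 : 0 < e / 2 by rewrite divr_gt0.
have [u [C [cu mC Ce uP]]] := lA _ e20; have [v [D [cv mD De vP]]] := lB _ e20.
exists (fun x => u x + v x - u x * v x), (C `|` D); split.
- by move=> x; exact: (cvgB (cvgD (cu x) (cv x)) (cvgM (cu x) (cv x))).
- exact: measurableU.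
- by rewrite (le_trans (measureU2 _ _ _))// (splitr e) EFinD leeD.
- move=> x /not_orP[nC nD]; rewrite uP// vP// !indicE in_setU.
  by case: (_ \in A); case: (_ \in B) => /=; ring.
Qed.

Let cvg_small (F : (set (borelRn R n))^nat) : (forall k, measurable (F k)) ->
  (forall k l, (k <= l)%N -> F l `<=` F k) -> \bigcap_k F k = set0 ->
  forall e, 0 < e -> exists k, (mu (F k) <= e%:E)%E.
Proof.
move=> mF dF F0 e e0.
have := nonincreasing_cvg_mu (mu_lty (mF 0%N)) mF.
rewrite F0 measure0 => /(_ measurable0) F0'.
have /F0'/cvge0_near_le/(_ _ e0)[k _ /(_ k (leqnn k)) Fk] :
  {homo F : n m / (n <= m)%N >-> (m <= n)%O}.
  by move=> k l kl; apply/subsetPset; exact: dF.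
by exists k.
Qed.

(** The functions [min 1 (k * dist)] differ from the indicator of the open set
    only where it is at distance less than 1/k from its complement, and these
    sets shrink to the empty set. *)
Lemma lusin_set_open A : open (A : set 'rV[R]_n) -> lusin_set A.
Proof.
move=> oA; have mA : measurable A by exact: sub_sigma_algebra.
split => // e e0; have [dist [cd d0 dA dnA]] := open_distance oA.
have cdk k : continuous (fun x => k.+1%:R * dist x : R).
  by move=> x; exact: (cvgM (cvg_cst _) (cd x)).
pose F k : set (borelRn R n) := A `&` [set x | k.+1%:R * dist x < 1].
have mF k : measurable (F k).
  apply: measurableI => //; apply: sub_sigma_algebra.
  apply: (@open_comp _ _ (fun x => k.+1%:R * dist x) [set y | y < 1]).
    by move=> x _; exact: cdk.
  exact: open_lt.
have [||k Fk] := cvg_small mF _ _ e0.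
- move=> k l kl x [Ax /= xl]; split => //=; apply: le_lt_trans xl.
  by rewrite ler_wpM2r// ler_nat ltnS.
- apply/seteqP; split => // x xF; have [Ax _] := xF 0%N I.
  have [k ke] := natSinv_lt (dA x Ax).
  have [_ /=] := xF k I; rewrite ltNge => /negP; apply.
  by rewrite -ler_pdivrMl// mulr1 ltW.
exists (fun x => Num.min 1 (k.+1%:R * dist x)), (F k); split => //.
  move=> x; apply: (@continuous_min _ _ (cst 1) (fun x => k.+1%:R * dist x)).
    exact: cst_continuous.
  exact: cdk.
move=> x nF; rewrite indicE; case: (boolP (x \in A)) => [/set_mem Ax|/negP xA].
  by rewrite min_l// leNgt; apply/negP => xk; apply: nF.
by rewrite dnA ?mulr0 ?min_r// => /mem_set.
Qed.

(** By continuity of the finite measure, a finite union fills the countable one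
    up to a small set. *)
Lemma lusin_set_bigcup (F : (set (borelRn R n))^nat) :
  (forall k, lusin_set (F k)) -> lusin_set (\bigcup_k F k).
Proof.
move=> lF; have mF k : measurable (F k) by have [] := lF k.
have mUF : measurable (\bigcup_k F k) by exact: bigcupT_measurable.
pose U k := \big[setU/set0]_(i < k) F i.
have lU k : lusin_set (U k).
  rewrite /U; elim/big_ind: _ => [|A B|i _] //; last exact: lusin_setU.
  rewrite -setCT; apply: lusin_setC; apply: lusin_set_open; exact: openT.
have mU k : measurable (U k) by have [] := lU k.
split => // e e0; have e20 : 0 < e / 2 by rewrite divr_gt0.
have [|||k Dk] := @cvg_small (fun k => \bigcup_k F k `\` U k) _ _ _ _ e20.
- by move=> k; exact: measurableD.
- move=> k l kl x [UFx nUl]; split => // Uk; apply: nUl.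
  exact: (subset_bigsetU kl).
- apply/seteqP; split => // x xD; have [[k _ Fkx] _] := xD 0%N I.
  have [_ ] := xD k.+1 I; apply; rewrite /U -bigcup_mkord; exists k => //=.
have [u [B [cu mB Be uP]]] := (lU k).2 _ e20.
exists u, (B `|` (\bigcup_k F k `\` U k)); split => //.
- by apply: measurableU => //; exact: measurableD.
- rewrite (le_trans (measureU2 _ _ _))//; first exact: measurableD.
  by rewrite (splitr e) EFinD leeD.
- move=> x /not_orP[nB nD]; rewrite uP// !indicE; congr (_%:R).
  suff -> : (x \in U k) = (x \in \bigcup_k F k) by [].
  apply/idP/idP; rewrite !inE.
    by rewrite /U -bigcup_mkord => -[i _ Fi]; exists i.
  by move=> UFx; apply: contrapT => nU; apply: nD.
Qed.

Lemma borel_lusin_set A : measurable A -> lusin_set A.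
Proof.
move: A; apply: smallest_sub; last by move=> A; exact: lusin_set_open.
split.
- by rewrite -setCT; apply: lusin_setC; apply: lusin_set_open; exact: openT.
- by move=> A lA; rewrite setTD; exact: lusin_setC.
- exact: lusin_set_bigcup.
Qed.

Lemma lusin_indic A : measurable A -> lusin (\1_A).
Proof.
move=> /borel_lusin_set[_ lA] e e0; have [u [B [cu mB Be uP]]] := lA _ e0.
by exists u, B; split => // x nB; rewrite uP// subrr normr0 ltW.
Qed.

Let sum_lt (L m : nat) : (m <= L)%N -> (\sum_(j < L) (j < m)%N = m)%N.
Proof.
elim: L m => [|L IH] m; first by rewrite leqn0 big_ord0 => /eqP.
rewrite big_ord_recr /= leq_eqVlt => /predU1P[->|mL].
  rewrite ltnSn addn1; congr S; rewrite -[RHS](IH L (leqnn L)).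
  by apply: eq_bigr => i _; rewrite ltn_ord ltnS ltnW.
rewrite ltnS in mL; by rewrite IH// ltnNge mL addn0.
Qed.

(** Layer-cake decomposition of a bounded function into finitely many
    superlevel sets. *)
Lemma lusin_bounded f (M : nat) : measurable_fun [set: borelRn R n] f ->
  (forall x, 0 <= f x <= M%:R) -> lusin f.
Proof.
move=> mf fM; apply: lusin_unif => e /natSinv_lt[k ke].
(* [f] is within 1/(k+1) of the sum of the indicators of the superlevel sets at
   the levels (j+1)/(k+1), divided by k+1. *)
pose A (j : 'I_(M * k.+1)) : set (borelRn R n) := [set x | j.+1%:R <= k.+1%:R * f x].
have mA j : measurable (A j).
  have mkf : measurable_fun [set: borelRn R n] (fun x => k.+1%:R * f x).
    exact: measurable_funM.
  have := mkf measurableT _ (measurable_itv `[(j.+1%:R : R), +oo[).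
  rewrite setTI; congr measurable; apply/seteqP.
  by split => x /=; rewrite in_itv /= andbT.
exists (fun x => \sum_j k.+1%:R^-1 * \1_(A j) x).
  by apply: lusin_sum => j; apply: lusinZ; exact: lusin_indic.
move=> x; have /andP[f0 fM'] := fM x; have k0 : 0 < (k.+1%:R : R) by [].
pose t := k.+1%:R * f x; have t0 : 0 <= t by rewrite mulr_ge0.
have fE : f x = k.+1%:R^-1 * t by rewrite /t mulKf// gt_eqF.
have tL : (Num.trunc t <= M * k.+1)%N.
  rewrite -ltnS truncn_lt_nat// (@le_lt_trans _ _ (M * k.+1)%:R) ?ltr_nat//.
  by rewrite /t natrM mulrC ler_pM2r.
rewrite -mulr_sumr (eq_bigr (fun j : 'I__ => ((j < Num.trunc t)%N)%:R)).
  rewrite -natr_sum sum_lt// fE -mulrBr normrM gtr0_norm ?invr_gt0//.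
  rewrite (le_trans _ (ltW ke))// ler_piMr ?invr_ge0//.
  by have := truncn_itv t0; rewrite -natr1 ler_norml; lra.
move=> j _; rewrite indicE truncn_gt_nat.
suff -> : (x \in A j) = (j.+1%:R <= t) by [].
by apply/idP/idP; rewrite ?inE.
Qed.

End Lusin.

(** * Borel minorants, and continuous approximations of small integral *)

Lemma negligible_bigcup_countType d (T : measurableType d) (R : realType)
    (nu : {measure set T -> \bar R}) (I : countType) (F : I -> set T) :
  (forall i, nu.-negligible (F i)) -> nu.-negligible (\bigcup_i F i).
Proof.
move=> F0; suff : nu.-negligible (\bigcup_k oapp F set0 (unpickle k)).
  by apply: negligibleS => x [i _ Fi]; exists (pickle i) => //; rewrite pickleK.
by apply: negligible_bigcup => k; case: unpickle => [i|];
  [exact: F0|exact: negligible_set0].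
Qed.

(** The superlevel sets of a completion-measurable function at rational levels
    contain measurable sets, up to null sets; the supremum of the levels whose
    set contains [x] is a measurable minorant. *)
Lemma completion_minorant d (T : measurableType d) (R : realType)
    (nu : {measure set T -> \bar R}) (f : T -> R) :
  (forall x, 0 <= f x) ->
  (forall B : set R, measurable B -> completed_algebra_gen nu (f @^-1` B)) ->
  exists phi : T -> R, [/\ measurable_fun setT phi, forall x, 0 <= phi x,
    forall x, phi x <= f x & {ae nu, forall x, phi x = f x}].
Proof.
move=> f0 mf.
have /choice[BN BNP] (q : rat) : exists BN : set T * set T,
    [/\ measurable BN.1, nu.-negligible BN.2 &
        BN.1 `|` BN.2 = [set x | ratr q < f x]].
  have [B mB [N N0 BNf]] := mf _ (measurable_itv `](ratr q : R), +oo[).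
  exists (B, N); split => //=; rewrite BNf.
  by apply/seteqP; split => x /=; rewrite in_itv /= andbT.
(* 0 keeps the supremum nonnegative and over a nonempty set. *)
pose S x : set R := [set y | y = 0 \/ exists2 q : rat, (BN q).1 x & y = ratr q].
have Bf q x : (BN q).1 x -> ratr q < f x.
  by move=> Bx; have [_ _ BNf] := BNP q; have : [set x | ratr q < f x] x
    by rewrite -BNf; left.
have Sub x : ubound (S x) (f x).
  by move=> _ [->//|[q Bx ->]]; exact/ltW/Bf.
have supS x : has_sup (S x) by split; [exists 0; left|exists (f x)].
have leS x y : S x y -> y <= sup (S x) by apply: sup_upper_bound; exact: supS.
exists (fun x => sup (S x)); split.
- apply: (measurability _ (RGenOInfty.measurableE R)).
  move=> _ [_ [a ->] <-]; rewrite setTI.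
  have [a0|a0] := ltP a 0.
    rewrite (_ : _ @^-1` _ = setT); first exact: measurableT.
    apply/seteqP; split => // x _ /=; rewrite in_itv /= andbT.
    by apply: lt_le_trans a0 _; apply: leS; left.
  rewrite (_ : _ @^-1` _ = \bigcup_q (if a < ratr q then (BN q).1 else set0)).
    by apply: bigcupT_measurable_rat => q; case: ifP => // _; have [] := BNP q.
  apply/seteqP; split => [x /=|x [q _]] /=; rewrite in_itv /= andbT.
    move=> /(sup_gt (supS x).1)[_ [->|[q Bx ->]]]; first by rewrite ltNge a0.
    by move=> aq; exists q => //; rewrite aq.
  case: ifP => // aq Bx; apply: lt_le_trans aq _; apply: leS; right.
  by exists q.
- by move=> x; apply: leS; left.
- by move=> x; exact: (ge_sup (supS x).1 (@Sub x)).
- suff : nu.-negligible (\bigcup_q (BN q).2).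
    apply: negligibleS => x /= /eqP; rewrite neq_lt => /orP[fx|]; last first.
      by rewrite ltNge (ge_sup (supS x).1 (@Sub x)).
    have [q] := rat_in_itvoo fx; rewrite in_itv /= => /andP[Sq qf].
    have [_ _ /seteqP[_ /(_ x qf)]] := BNP q => -[Bx|Nx]; last by exists q.
    by move: Sq; rewrite ltNge leS//; right; exists q.
  by apply: negligible_bigcup_countType => q; have [] := BNP q.
Qed.

Lemma clamp_dist (R : realDomainType) (M p u : R) : 0 <= p -> p <= M ->
  `|p - Num.min M (Num.max 0 u)| <= `|p - u|.
Proof.
move=> p0 pM; have [u0|u0] := leP 0 u; last first.
  rewrite min_r ?(le_trans p0)// subr0 !ger0_norm//; lra.
have [Mu|//] := leP M u; rewrite !ler0_norm; lra.
Qed.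

Section CompactApprox.
Context (R : realType) (n : nat).
Local Notation lam := (lebesgue R n).
Local Notation borel := (borelRn R n).

Let cube_lty r : 0 < r ->
  (lebesgue_borel (cube (0 : 'rV[R]_n) r : set borel) < +oo)%E.
Proof. by move=> r0; exact: lebesgue_outer_ocbox_lty. Qed.

(** The Lusin approximation [v] of [phi], clamped to [0, M] and cut off, is
    taken for the sum of [mu] and Lebesgue measure on a cube [C] that contains
    its support. So the integral of [v] exceeds that of [phi] by at most
    [e' * (L + M)], where [L] is the measure of [C], and dividing by
    [1 + e' * (L + M)] restores the bound 1. *)
Lemma compact_approx (mu : {measure set borel -> \bar R}) (phi : 'rV[R]_n -> R)
    (M : nat) (r e : R) : (mu setT < +oo)%E ->
  measurable_fun [set: borel] phi -> (forall x, 0 <= phi x <= M%:R) ->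
  0 <= r -> (forall x, r < `|x| -> phi x = 0) ->
  (\int[lam]_x (phi x)%:E <= 1)%E -> 0 < e ->
  exists (psi : 'rV[R]_n -> R) (B : set borel), [/\ continuous psi,
    forall x, 0 <= psi x <= M%:R,
    forall x, r + 1 <= `|x| -> psi x = 0, (\int[lam]_x (psi x)%:E <= 1)%E &
    [/\ measurable B, (mu B <= e%:E)%E & forall x, ~ B x -> `|phi x - psi x| <= e]].
Proof.
move=> muT mphi phiM r0 phir phi1 e0.
have r20 : 0 < r + 2 by rewrite ltr_wpDl.
pose C : set borel := cube 0 (r + 2).
have mC : measurable C by exact: ocbox_borel.
have Clty := cube_lty r20.
pose L : R := fine (@lebesgue_borel R n C).
have CL : @lebesgue_borel R n C = L%:E.
  by rewrite fineK// ge0_fin_numE ?lebesgue_outer_ge0.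
have L0 : 0 <= L by rewrite fine_ge0 ?lebesgue_outer_ge0.
pose mu' := measure_add mu (mrestr (@lebesgue_borel R n) mC).
have mu'T : (mu' setT < +oo)%E.
  have CT : (mrestr (@lebesgue_borel R n) mC setT < +oo)%E by rewrite /mrestr setTI.
  by rewrite /mu' measure_addE; exact: lte_add_pinfty muT CT.
(* Rescaling moves the values, which are at most [M], by at most
   [M * e' * (L + M)]; so the total error is at most [e' * (1 + eta)]. *)
pose eta : R := (M%:R + 1) * (L + M%:R).
have eta0 : 0 <= eta by rewrite mulr_ge0// addr_ge0.
pose e' : R := e / 2 / (1 + eta).
have e'0 : 0 < e' by rewrite !divr_gt0// ltr_wpDr.
have e'e : e' * (1 + eta) = e / 2 by rewrite /e' divfK// gt_eqF// ltr_wpDr.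
have [u [B [cu mB Be uP]]] := lusin_bounded mu'T mphi phiM e'0.
have Be' : (mu B + @lebesgue_borel R n (B `&` C) <= e'%:E)%E.
  by move: Be; rewrite -[X in (X <= _)%E -> _]/(mu' B) /mu' measure_addE.
have muB : (mu B <= e'%:E)%E by apply: le_trans Be'; rewrite leeDl ?measure_ge0.
have lamB : (lam (B `&` C) <= e'%:E)%E.
  by apply: le_trans Be'; rewrite leeDr ?measure_ge0.
pose v x := Num.min M%:R (Num.max 0 (u x)) * cutoff r x.
have v0 x : 0 <= v x by rewrite mulr_ge0 ?cutoff_ge0// le_min ler0n le_max lexx.
have vM x : v x <= M%:R.
  rewrite /v -[leRHS]mulr1 ler_pM ?cutoff_ge0 ?cutoff_le1// ?ge_min ?lexx//.
  by rewrite le_min ler0n le_max lexx.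
have cv : continuous v.
  have cw : continuous (fun x => Num.min M%:R (Num.max 0 (u x))).
    move=> x; apply: (@continuous_min _ _ (cst M%:R) (fun x => Num.max 0 (u x))).
      exact: cst_continuous.
    by apply: (@continuous_max _ _ (cst 0) u); [exact: cst_continuous|exact: cu].
  by move=> x; exact: (cvgM (cw x) (@cutoff_continuous R n r x)).
have vr x : r + 1 <= `|x| -> v x = 0 by move=> xr; rewrite /v cutoff_out ?mulr0.
have vphi x : ~ B x -> `|phi x - v x| <= e'.
  move=> /uP; have /andP[p0 pM] := phiM x.
  have [xr|xr] := leP `|x| r.
    by rewrite /v cutoff_in// mulr1; apply: le_trans; exact: clamp_dist p0 pM.
  rewrite phir// !sub0r !normrN (ger0_norm (v0 x)) => ux.
  have h1 : Num.min M%:R (Num.max 0 (u x)) <= e'.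
    by rewrite ge_min ge_max (ltW e'0) (le_trans (ler_norm _) ux) orbT.
  rewrite /v -[leRHS]mulr1 ler_pM ?cutoff_ge0 ?cutoff_le1//.
  by rewrite le_min ler0n le_max lexx.
have iv : (\int[lam]_x (v x)%:E <= (1 + e' * (L + M%:R))%:E)%E.
  have mBC : measurable (B `&` C : set (lebesgueRn R n)).
    by apply: borel_lebesgue_measurable; exact: measurableI.
  have mC' : measurable (C : set (lebesgueRn R n)) by exact: ocbox_measurable.
  have mphi' := borel_lebesgue_measurable_fun mphi.
  have phi0 x : 0 <= phi x by have /andP[] := phiM x.
  have mv := continuous_lebesgue_measurable cv.
  have vle x : v x <= 1 * phi x + e' * \1_C x + M%:R * \1_(B `&` C) x.
    rewrite !indicE in_setI mul1r; case: (boolP (x \in C)) => xC /=.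
      case: (boolP (x \in B)) => xB /=.
        by have := vM x; have := phi0 x; move: e'0; lra.
      by have := vphi x (fun Bx => negP xB (mem_set Bx)); rewrite ler_norml; lra.
    rewrite vr; first by rewrite andbF /= !mulr0 !addr0.
    rewrite leNgt; apply/negP => xr; move/negP: xC; apply; apply: mem_set.
    by apply: norm_cube; rewrite sub0r normrN (lt_trans xr)// ltrD2l ltr1n.
  have := @ge0_integral_le_indic2 _ _ _ lam 1 e' M%:R phi v C (B `&` C)
    mphi' mv mC' mBC ler01 (ltW e'0) (ler0n _ _) phi0 v0 vle.
  move/le_trans; apply; rewrite mul1e mulrDr addrA !EFinD.
  apply: leeD; first apply: leeD => //.
    by rewrite (EFinM e' L) -CL.
  by rewrite mulrC (EFinM M%:R e') lee_wpmul2l// lee_fin.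
pose t := e' * (L + M%:R); have t0 : 0 <= t by rewrite mulr_ge0 ?addr_ge0// ltW.
have t1 : 0 < 1 + t by rewrite ltr_wpDr.
pose c := (1 + t)^-1; have c0 : 0 <= c by rewrite invr_ge0 ltW.
have c1 : c <= 1 by rewrite invf_le1// lerDl.
have ct : 1 - c <= t.
  have : c * (1 + t) = 1 by rewrite mulVf// gt_eqF.
  have := ler_wpM2r t0 c1; lra.
have te : e' + M%:R * t <= e.
  suff : e' + M%:R * t <= e' * (1 + eta) by rewrite e'e; lra.
  have := mulr_ge0 (ltW e'0) (addr_ge0 L0 (ler0n R M)); rewrite /t /eta; lra.
exists (fun x => c * v x), B; split.
- by move=> x; exact: (cvgM (cvg_cst _) (cv x)).
- by move=> x; rewrite mulr_ge0//= (le_trans _ (vM x))// ler_piMl.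
- by move=> x xr; rewrite vr ?mulr0.
- rewrite (@ge0_integral_realZ _ _ _ lam)//; last first.
    exact: continuous_lebesgue_measurable.
  apply: (le_trans (lee_wpmul2l _ iv)); first by rewrite lee_fin.
  by rewrite -EFinM lee_fin mulVf// gt_eqF.
- split => //.
    apply: le_trans muB _; rewrite lee_fin.
    by have := mulr_ge0 (ler0n R M) t0; lra.
  move=> x nB; rewrite -(subrKA (v x)) (le_trans (ler_normD _ _))//.
  apply: le_trans te; apply: lerD; first exact: vphi.
  rewrite -{1}(mul1r (v x)) -mulrBl normrM (ger0_norm (v0 x)) mulrC.
  rewrite ger0_norm ?subr_ge0//.
  by rewrite ler_pM// subr_ge0.
Qed.

End CompactApprox.

(** * Convergence almost everywhere *)

Section Truncation.
Context (R : realType) (n : nat) (phi : 'rV[R]_n -> R).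
Hypotheses (phi0 : forall x, 0 <= phi x).

Definition truncation (k : nat) x : R :=
  Num.min (phi x) k%:R * \1_[set y | `|y| <= k%:R] x.

Lemma truncation_ge0 k x : 0 <= truncation k x.
Proof. by rewrite mulr_ge0// le_min phi0 ler0n. Qed.

Let indic_le1 (A : set 'rV[R]_n) x : \1_A x <= 1 :> R.
Proof. by rewrite indicE; case: (_ \in _). Qed.

Lemma truncation_le k x : truncation k x <= phi x.
Proof.
by rewrite -[leRHS]mulr1 ler_pM ?indic_le1// ?le_min ?phi0 ?ler0n// ge_min lexx.
Qed.

Lemma truncation_bound k x : truncation k x <= k%:R.
Proof.
by rewrite -[leRHS]mulr1 ler_pM ?indic_le1// ?le_min ?phi0 ?ler0n// ge_min lexx orbT.
Qed.

Lemma truncation_out k x : k%:R < `|x| -> truncation k x = 0.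
Proof.
move=> xk; rewrite /truncation indicE memNset ?mulr0//= => /(lt_le_trans xk).
by rewrite ltxx.
Qed.

Lemma truncation_eq x : \forall k \near \oo, truncation k x = phi x.
Proof.
exists (maxn (Num.trunc (phi x)).+1 (Num.trunc `|x|).+1) => // k /=.
rewrite geq_max => /andP[pk xk].
have h1 : phi x <= k%:R by rewrite (le_trans (ltW (truncnS_gt _)))// ler_nat.
have h2 : `|x| <= k%:R by rewrite (le_trans (ltW (truncnS_gt _)))// ler_nat.
by rewrite /truncation min_l// indicE mem_set ?mulr1.
Qed.

Lemma truncation_measurable k : measurable_fun [set: borelRn R n] phi ->
  measurable_fun [set: borelRn R n] (truncation k).
Proof.
move=> mphi; apply: measurable_funM.
  by apply: measurable_minr => //; exact: measurable_cst.
apply: measurable_indic; rewrite -[[set y | _]]setCK; apply: measurableC.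
apply: sub_sigma_algebra.
rewrite (_ : ~` _ = (fun y : 'rV[R]_n => `|y|) @^-1` [set s | k%:R < s]).
  apply: open_comp; last exact: open_gt.
  by move=> y _; exact: norm_continuous.
by apply/seteqP; split => y /=; rewrite ltNge => /negP.
Qed.

End Truncation.

Section AlmostEverywhere.
Context (R : realType) (n : nat) (g : 'rV[R]_n -> R).
Local Notation lam := (lebesgue R n).
Local Notation borel := (borelRn R n).
Hypotheses (n_gt0 : (0 < n)%N) (pdf_g : pdf g).
Hypotheses (cg : continuous g) (vg : vanishing g).

(** Borel-Cantelli: the exceptional sets at stage [k] have measure at most
    2^-(k+1). *)
Lemma approx_ae_borel (nu : {sigma_finite_measure set borel -> \bar R})
    (phi : 'rV[R]_n -> R) : measurable_fun [set: borel] phi ->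
  (forall x, 0 <= phi x) -> (\int[lam]_x (phi x)%:E <= 1)%E ->
  exists2 h, mixture_seq g h & {ae nu, forall x, h m x @[m --> \oo] --> phi x}.
Proof.
move=> mphi phi0 phi1.
have /sigma_finiteP[F [FT Fnd Ffin]] := sigma_finiteT nu.
pose e k : R := 1 / (2 ^ k.+1)%:R.
have e0 k : 0 < e k by rewrite divr_gt0// ltr0n expn_gt0.
have e_small d : 0 < d -> \forall k \near \oo, e k <= d.
  move=> d0; have [N _ NP] := near_infty_natSinv_lt (PosNum d0).
  exists N => // k Nk; rewrite /e mul1r (le_trans _ (ltW (NP k Nk)))//.
  by rewrite lef_pV2 ?posrE ?ltr0n ?expn_gt0// ler_nat ltnW// ltn_expl.
have /choice[HB HBP] (k : nat) : exists HB : ('rV[R]_n -> R) * set borel,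
    [/\ exists m, (0 < m)%N /\ mixtures m g HB.1, measurable HB.2,
      (nu (HB.2 `&` F k) <= (e k)%:E)%E &
      forall x, ~ HB.2 x -> `|truncation phi k x - HB.1 x| <= 2 * e k].
  have [mF Flty] := Ffin k.
  have nuF : (mrestr nu mF setT < +oo)%E by rewrite /mrestr setTI.
  have mt := truncation_measurable k mphi.
  have t0 x : 0 <= truncation phi k x <= k%:R.
    by rewrite truncation_ge0// truncation_bound.
  have t1 : (\int[lam]_x (truncation phi k x)%:E <= 1)%E.
    apply: le_trans phi1; apply: (@ge0_le_integral_real _ _ _ lam).
    - exact: borel_lebesgue_measurable_fun.
    - exact: borel_lebesgue_measurable_fun.
    - exact: truncation_ge0.
    - exact: truncation_le.
  have [psi [B [cpsi psi0 psir psi1 [mB nB BP]]]] :=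
    compact_approx nuF mt t0 (ler0n _ k) (@truncation_out _ _ phi k) t1 (e0 k).
  have psi_ge0 x : 0 <= psi x by have /andP[] := psi0 x.
  have [m [h [m0 mh hP]]] :=
    approx_compact_support n_gt0 pdf_g cg vg cpsi psi_ge0 psir psi1 (e0 k).
  exists (h, B); split => //; first by exists m.
  move=> x nBx; rewrite -(subrKA (psi x)) (le_trans (ler_normD _ _))//.
  by have := BP x nBx; have := hP x; lra.
have mH k : exists m, (0 < m)%N /\ mixtures m g (HB k).1 by have [] := HBP k.
have [h hm [K [Koo hK]]] := mixture_seq_reindex mH.
exists h => //; pose A k := (HB k).2 `&` F k.
have mA k : measurable (A k).
  by have [_ + _ _] := HBP k; move=> ?; apply: measurableI => //; have [] := Ffin k.
exists (lim_sup_set A); split.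
- apply: bigcap_measurable => // k _; exact: bigcup_measurable.
- apply: lim_sup_set_cvg0 => //.
  apply: (@le_lt_trans _ _ (\sum_(0 <= k <oo) (e k)%:E)%E).
    by apply: lee_nneseries => k _ *; [exact: measure_ge0|have [] := HBP k].
  by apply: le_lt_trans (epsilon_trick0 xpredT ler01) _; rewrite ltry.
move=> x /=; apply: contra_notP => nlim.
have [N NP] : exists N, forall k, (N <= k)%N -> ~ A k x.
  apply: contrapT => nN; apply: nlim => N _; apply: contrapT => nA.
  by apply: nN; exists N => k Nk Akx; apply: nA; exists k.
have [j _ Fjx] : (\bigcup_i F i) x by rewrite -FT.
have HBx : (HB k).1 x @[k --> \oo] --> phi x.
  apply/cvgrPdist_le => d d0; have d20 : 0 < d / 2 by rewrite divr_gt0.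
  near=> k.
  have nB : ~ (HB k).2 x.
    move=> Bx; apply: (NP k); first by near: k; exact: nbhs_infty_ge.
    have jk : (j <= k)%N by near: k; exact: nbhs_infty_ge.
    by split => //; have /subsetPset := Fnd j k jk; exact.
  have [_ _ _ /(_ x nB)] := HBP k.
  rewrite (near (truncation_eq phi x) k)//.
  have : e k <= d / 2 by near: k; exact: e_small.
  by lra.
have HKx : (HB (K m)).1 x @[m --> \oo] --> phi x.
  by have := @cvg_comp _ _ _ K (fun k => (HB k).1 x) _ _ _ Koo HBx; exact.
apply: cvg_trans HKx; apply: near_eq_cvg.
by apply: filterS hK => m ->.
Unshelve. all: by end_near. Qed.

(** The minorant costs nothing: it has the limit wanted [nu]-almost everywhere,
    and its Lebesgue integral is at most that of [f]. *)
Lemma approx_ae (nu : {sigma_finite_measure set borel -> \bar R})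
    (f : 'rV[R]_n -> R) : pdf f -> completion_measurable nu f ->
  exists2 h, mixture_seq g h & {ae nu, forall x, h m x @[m --> \oo] --> f x}.
Proof.
move=> [mf f0 f1] cf.
have [phi [mphi phi0 phif phiE]] := @completion_minorant _ _ _ nu f f0 cf.
have phi1 : (\int[lam]_x (phi x)%:E <= 1)%E.
  rewrite -f1; apply: (@ge0_le_integral_real _ _ _ lam) => //.
  exact: borel_lebesgue_measurable_fun.
have [h hm hP] := approx_ae_borel nu mphi phi0 phi1.
exists h => //; apply: filterS2 phiE hP => x <-; exact.
Qed.

Lemma approx_ae_lebesgue (f : 'rV[R]_n -> R) : pdf f ->
  exists2 h, mixture_seq g h & {ae lam, forall x, h m x @[m --> \oo] --> f x}.
Proof.
move=> pf; have [mf f0 f1] := pf.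
have cf : completion_measurable (@lebesgue_borel R n) f.
  move=> B mB; apply: lebesgue_completion.
  by have := mf measurableT B mB; rewrite setTI.
have [h hm [N [mN N0 NP]]] := approx_ae (nu := @lebesgue_borel R n) pf cf.
exists h => //; exists N; split => //; exact: borel_lebesgue_measurable.
Qed.

End AlmostEverywhere.

(** * Convergence in the mean *)

Section LpGeneral.
Context d (T : measurableType d) (R : realType) (mu : {measure set T -> \bar R}).

Let norm_powR_measurable p (u : T -> R) : measurable_fun setT u ->
  measurable_fun setT (fun x => `|u x| `^ p).
Proof.
move=> mu'; apply: measurableT_comp (measurable_powR p) _.
exact: measurableT_comp.
Qed.

Lemma Lnorm_le (u : T -> R) (p e : R) : 0 < p -> 0 <= e ->
  (\int[mu]_x (`|u x| `^ p)%:E <= (e `^ p)%:E)%E ->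
  ('N[mu]_p%:E[EFin \o u] <= e%:E)%E.
Proof.
move=> p0 e0 ue; rewrite unlock /Lnorm.
rewrite (eq_integral (fun x => (`|u x| `^ p)%:E))//.
have -> : e%:E = ((e `^ p)%:E `^ p^-1)%E :> \bar R.
  by rewrite poweR_EFin -powRrM divff ?gt_eqF// powRr1.
apply: gt0_ler_poweR => //; rewrite ?invr_ge0 ?(ltW p0)// in_itv/= leey andbT.
  by apply: integral_ge0 => x _; rewrite lee_fin powR_ge0.
by rewrite lee_fin powR_ge0.
Qed.

(** [|u|^p = |u|^(p-1) * |u|], and the first factor is at most [e^(p-1)] since
    [p > 1]. *)
Lemma integral_powR_interpolation (u : T -> R) (p e c : R) : 1 < p -> 0 <= e ->
  measurable_fun setT u -> (forall x, `|u x| <= e) ->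
  (\int[mu]_x `|u x|%:E <= c%:E)%E ->
  (\int[mu]_x (`|u x| `^ p)%:E <= (e `^ (p - 1) * c)%:E)%E.
Proof.
move=> p1 e0 mu' ue uc; have p0 : 0 < p by lra.
have mnu : measurable_fun setT (fun x => `|u x|) by exact: measurableT_comp.
apply: (@le_trans _ _ (\int[mu]_x (e `^ (p - 1) * `|u x|)%:E)%E).
  apply: ge0_le_integral_real.
  - exact: norm_powR_measurable.
  - exact: measurable_funM.
  - by move=> x; exact: powR_ge0.
  - move=> x; rewrite -mulr_powRB1// mulrC ler_wpM2r//.
    by apply: ge0_ler_powR; rewrite ?nnegrE// subr_ge0 ltW.
by rewrite ge0_integral_realZ ?powR_ge0// EFinM lee_wpmul2l// lee_fin powR_ge0.
Qed.

Lemma Lp_dominated (f : T -> R) (u : nat -> T -> R) (p : R) : 0 < p ->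
  measurable_fun setT f -> (forall k, measurable_fun setT (u k)) ->
  (forall k x, 0 <= u k x <= f x) ->
  {ae mu, forall x, \forall k \near \oo, u k x = f x} ->
  (\int[mu]_x (`|f x| `^ p)%:E < +oo)%E ->
  (\int[mu]_x (`|f x - u k x| `^ p)%:E)%E @[k --> \oo] --> 0%E.
Proof.
move=> p0 mf mu' uf ufx fp.
pose F k x := (`|f x - u k x| `^ p)%:E.
have mF k : measurable_fun setT (F k).
  by apply/measurable_EFinP; apply: norm_powR_measurable; exact: measurable_funB.
have [|||_ _] := @dominated_convergence _ _ _ mu setT measurableT F (cst 0%E)
    (fun x => (`|f x| `^ p)%:E) mF (measurable_cst _).
- apply: filterS ufx => x ufx _; apply: cvg_near_cst; apply: filterS ufx => k.
  by rewrite /F => ->; rewrite subrr normr0 powR0 ?gt_eqF.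
- apply/integrableP; split.
    by apply/measurable_EFinP; exact: norm_powR_measurable.
  by under eq_integral do rewrite gee0_abs ?lee_fin ?powR_ge0//.
- apply: nearW => x k _; rewrite /F gee0_abs ?lee_fin ?powR_ge0//.
  have /andP[u0 u1] := uf k x.
  apply: ge0_ler_powR; rewrite ?nnegrE ?(ltW p0)//.
  have fx0 := le_trans u0 u1; have fu0 : 0 <= f x - u k x by rewrite subr_ge0.
  by rewrite (ger0_norm fx0) (ger0_norm fu0) gerBl.
by rewrite integral0.
Qed.

(** Scheffe: as both functions have integral 1, the L1 distance is twice the
    integral of the positive part of [f - h k], which [f] dominates. *)
Lemma scheffe (f : T -> R) (h : nat -> T -> R) :
  measurable_fun setT f -> (forall k, measurable_fun setT (h k)) ->
  (forall x, 0 <= f x) -> (forall k x, 0 <= h k x) ->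
  (\int[mu]_x (f x)%:E = 1)%E -> (forall k, \int[mu]_x (h k x)%:E = 1)%E ->
  {ae mu, forall x, h k x @[k --> \oo] --> f x} ->
  (\int[mu]_x `|f x - h k x|%:E)%E @[k --> \oo] --> 0%E.
Proof.
move=> mf mh f0 h0 f1 h1 hf.
pose D k x : R := Num.max (f x - h k x) 0.
have mD k : measurable_fun setT (D k).
  by apply: measurable_maxr; [exact: measurable_funB|exact: measurable_cst].
have D0 k x : 0 <= D k x by rewrite le_max lexx orbT.
have Df k x : D k x <= f x by rewrite ge_max f0 gerBl h0.
have mabs k : measurable_fun setT (fun x => `|f x - h k x|).
  by apply: measurableT_comp => //; exact: measurable_funB.
have absE k : (\int[mu]_x `|f x - h k x|%:E = 2%:E * \int[mu]_x (D k x)%:E)%E.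
  have : (\int[mu]_x (`|f x - h k x| + f x)%:E =
          \int[mu]_x (2 * D k x + h k x)%:E)%E.
    apply: eq_integral => x _; congr EFin; rewrite /D.
    have [fh|fh] := leP 0 (f x - h k x).
      by rewrite ger0_norm//; lra.
    by rewrite ltr0_norm//; lra.
  rewrite ge0_integral_realD// ge0_integral_realD//; last 2 first.
  - exact: measurable_funM.
  - by move=> x; rewrite mulr_ge0.
  rewrite f1 h1 ge0_integral_realZ// => /(congr1 (fun y => (y - 1)%E)).
  by rewrite !addeK.
have D_cvg : (\int[mu]_x (D k x)%:E)%E @[k --> \oo] --> 0%E.
  have [|||_ _] := @dominated_convergence _ _ _ mu setT measurableT
    (fun k x => (D k x)%:E) (cst 0%E) (EFin \o f)
    (fun k => proj2 (measurable_EFinP _ _) (mD k)) (measurable_cst _).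
  - apply: filterS hf => x hfx _; apply/fine_cvgP; split; first exact: nearW.
    apply/cvgrPdist_le => e e0; move/cvgrPdist_le: hfx => /(_ e e0).
    apply: filterS => k.
    move=> /(le_trans (ler_norm _)) fe; rewrite sub0r normrN /= (ger0_norm (D0 k x)).
    by rewrite ge_max fe ltW.
  - apply/integrableP; split; first exact/measurable_EFinP.
    by under eq_integral do rewrite /= ger0_norm//; rewrite f1 ltry.
  - by apply: nearW => x k _; rewrite /= lee_fin ger0_norm.
  by rewrite integral0.
under eq_fun do rewrite absE.
by rewrite -(mule0 2%:E); apply: cvgeZl.
Qed.

Lemma integral_convex (I : finType) (c : I -> R) (u : I -> T -> R) :
  (forall i, measurable_fun setT (u i)) -> (forall i x, 0 <= u i x) ->
  (forall i, 0 <= c i) -> \sum_i c i = 1 ->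
  (forall i, \int[mu]_x (u i x)%:E = 1)%E ->
  measurable_fun setT (fun x => \sum_i c i * u i x) /\
  (\int[mu]_x (\sum_i c i * u i x)%:E = 1)%E.
Proof.
move=> mu' u0 c0 c1 u1.
have mcu i : measurable_fun setT (fun x => c i * u i x) by exact: measurable_funM.
split; first exact: measurable_sum.
under eq_integral do rewrite -sumEFin.
rewrite ge0_integral_sum//.
- rewrite -[RHS](congr1 EFin c1) -sumEFin; apply: eq_bigr => i _.
  by rewrite ge0_integral_realZ// u1 mule1.
- by move=> i; exact/measurable_EFinP.
- by move=> i x _; rewrite lee_fin mulr_ge0.
Qed.

Lemma measurable_funZ (k : R) (u : T -> R) : measurable_fun setT u ->
  measurable_fun setT (fun x => k * u x).
Proof. by move=> mu'; exact: measurable_funM. Qed.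

End LpGeneral.

Section MixtureIntegral.
Context (R : realType) (n : nat) (g : 'rV[R]_n -> R).
Local Notation lam := (lebesgue R n).

Lemma mixture_pdf m h : pdf g -> mixtures m g h -> pdf h.
Proof.
move=> [mg g0 g1] [c [mu [s [[c1 c0] s0 ->]]]].
have sn0 i : 0 < (s i ^+ n)^-1 by rewrite invr_gt0 exprn_gt0.
have mgi i : measurable_fun [set: lebesgueRn R n]
    (fun x => g ((s i)^-1 *: (x - mu i))).
  exact: (measurableT_comp mg (affine_measurable (mu i) (s0 i))).
have gi1 i : (\int[lam]_x ((s i ^+ n)^-1 * g ((s i)^-1 *: (x - mu i)))%:E = 1)%E.
  have g0' x : (0 <= (g x)%:E)%E by rewrite lee_fin.
  have gI := integral_affine (mu i) (s0 i) (proj2 (measurable_EFinP _ _) mg) g0'.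
  rewrite (@ge0_integral_realZ _ _ _ lam _ _ (mgi i) (ltW (sn0 i)) (fun x => g0 _)).
  rewrite -[X in (_ * X)%E]/(\int[lam]_x (EFin \o g) ((s i)^-1 *: (x - mu i)))%E gI.
  by rewrite g1 mule1 -EFinM mulVf// gt_eqF// exprn_gt0.
have [mh h1] := @integral_convex _ _ _ lam _ (fun i => c i 0) _
  (fun i => measurable_funZ _ (mgi i))
  (fun i x => mulr_ge0 (ltW (sn0 i)) (g0 _)) c0 c1 gi1.
split => // x; apply: sumr_ge0 => i _.
exact: mulr_ge0 (c0 i) (mulr_ge0 (ltW (sn0 i)) (g0 _)).
Qed.

End MixtureIntegral.

(** * Approximation in Lp and the main theorem *)

Section LpApproximation.
Context (R : realType) (n : nat) (g : 'rV[R]_n -> R).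
Local Notation lam := (lebesgue R n).
Local Notation borel := (borelRn R n).
Hypotheses (n_gt0 : (0 < n)%N) (pdf_g : pdf g).
Hypotheses (cg : continuous g) (vg : vanishing g).

Lemma Lp_normTE p (u : 'rV[R]_n -> R) :
  Lp_norm [set: 'rV[R]_n] p u = ('N[lam]_p[EFin \o u])%E.
Proof. by rewrite /Lp_norm patch_setT. Qed.

Lemma Lp_norm_le (u : 'rV[R]_n -> R) (p e : R) : 0 < p -> 0 <= e ->
  (\int[lam]_x (`|u x| `^ p)%:E <= (e `^ p)%:E)%E ->
  (Lp_norm [set: 'rV[R]_n] p%:E u <= e%:E)%E.
Proof. by move=> p0 e0 ue; rewrite Lp_normTE; exact: Lnorm_le. Qed.

Lemma Lp_normD (u v : 'rV[R]_n -> R) (p : R) : 1 <= p ->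
  lebesgue_measurable u -> lebesgue_measurable v ->
  (Lp_norm [set: 'rV[R]_n] p%:E (u \+ v)%R <=
     Lp_norm [set: 'rV[R]_n] p%:E u + Lp_norm [set: 'rV[R]_n] p%:E v)%E.
Proof.
by move=> p1 mu mv; rewrite !Lp_normTE; exact: minkowski_EFin.
Qed.

(** The difference is at most [d] off [B], at most [M] on [B], and 0 outside
    the cube [C]; for [d <= 1], the integral of its p-th power is therefore at
    most [d * |C| + M^p * |B|]. *)
Lemma approx_Lp_bounded (phi : 'rV[R]_n -> R) (M : nat) (r p e : R) : 1 <= p ->
  measurable_fun [set: borel] phi -> (forall x, 0 <= phi x <= M%:R) ->
  0 <= r -> (forall x, r < `|x| -> phi x = 0) ->
  (\int[lam]_x (phi x)%:E <= 1)%E -> 0 < e ->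
  exists psi : 'rV[R]_n -> R, [/\ continuous psi, forall x, 0 <= psi x,
    forall x, r + 1 <= `|x| -> psi x = 0, (\int[lam]_x (psi x)%:E <= 1)%E &
    (Lp_norm [set: 'rV[R]_n] p%:E (phi \- psi)%R <= e%:E)%E].
Proof.
move=> p1 mphi phiM r0 phir phi1 e0.
have p0 : 0 < p by exact: lt_le_trans p1.
pose C : set borel := cube 0 (r + 2).
have mC : measurable C by exact: ocbox_borel.
have Clty : (@lebesgue_borel R n C < +oo)%E by exact: lebesgue_outer_ocbox_lty.
pose L : R := fine (@lebesgue_borel R n C).
have CL : @lebesgue_borel R n C = L%:E.
  by rewrite fineK// ge0_fin_numE ?lebesgue_outer_ge0.
have L0 : 0 <= L by rewrite fine_ge0 ?lebesgue_outer_ge0.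
have muT : (mrestr (@lebesgue_borel R n) mC setT < +oo)%E by rewrite /mrestr setTI.
have ep0 : 0 < e `^ p by rewrite powR_gt0.
pose K : R := L + M%:R `^ p + 1.
have K0 : 0 < K by rewrite ltr_wpDl// addr_ge0// powR_ge0.
pose d : R := Num.min 1 (e `^ p / K).
have d0 : 0 < d by rewrite lt_min ltr01 divr_gt0.
have d1 : d <= 1 by rewrite ge_min lexx.
have dK : d * K <= e `^ p by rewrite -ler_pdivlMr// ge_min lexx orbT.
have [psi [B [cpsi psiM psir psi1 [mB muB BP]]]] :=
  compact_approx muT mphi phiM r0 phir phi1 d0.
exists psi; split => //; first by move=> x; have /andP[] := psiM x.
apply: Lp_norm_le => //; first exact: ltW.
have mBC : measurable (B `&` C) by exact: measurableI.
have lamBC : (@lebesgue_borel R n (B `&` C) <= d%:E)%E by exact: muB.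
have mdiff : lebesgue_measurable (phi \- psi).
  apply: measurable_funB; first exact: borel_lebesgue_measurable_fun.
  exact: continuous_lebesgue_measurable.
have mdp : measurable_fun [set: lebesgueRn R n] (fun x => `|phi x - psi x| `^ p).
  by apply: measurableT_comp (measurable_powR p) _; exact: measurableT_comp.
have le_dp x : `|phi x - psi x| `^ p <=
    0 * cst 0 x + d * \1_C x + M%:R `^ p * \1_(B `&` C) x.
  rewrite mul0r add0r !indicE in_setI; case: (boolP (x \in C)) => xC; last first.
    have xr : r + 1 <= `|x|.
      rewrite leNgt; apply/negP => xr; move/negP: xC; apply; apply: mem_set.
      by apply: norm_cube; rewrite sub0r normrN (lt_trans xr)// ltrD2l ltr1n.
    rewrite psir// phir; last by rewrite (lt_le_trans _ xr)// ltrDl.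
    by rewrite subrr normr0 powR0 ?gt_eqF// andbF !mulr0 addr0.
  rewrite andbT mulr1; case: (boolP (x \in B)) => xB /=.
    rewrite mulr1 ler_wpDl ?(ltW d0)//.
    have /andP[a0 aM] := phiM x; have /andP[b0 bM] := psiM x.
    by apply: ge0_ler_powR; rewrite ?nnegrE ?(ltW p0)// ler_norml; lra.
  rewrite mulr0 addr0; have dx := BP x (fun Bx => negP xB (mem_set Bx)).
  apply: (@le_trans _ _ (d `^ p)).
    by apply: ge0_ler_powR; rewrite ?nnegrE ?(ltW p0)// ltW.
  by apply: ge1r_powR; rewrite ?d0.
have := @ge0_integral_le_indic2 _ _ _ lam 0 d (M%:R `^ p) (cst 0) _ C (B `&` C)
  (measurable_cst _) mdp (borel_lebesgue_measurable mC)
  (borel_lebesgue_measurable mBC)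
  (lexx 0) (ltW d0) (powR_ge0 _ _) (fun=> lexx 0) (fun x => powR_ge0 _ _) le_dp.
move/le_trans; apply; rewrite mul0e add0e.
apply: (@le_trans _ _ (d%:E * L%:E + (M%:R `^ p)%:E * d%:E)%E).
  by apply: leeD; [rewrite -CL|apply: lee_wpmul2l; rewrite // lee_fin powR_ge0].
rewrite -!EFinM -EFinD lee_fin (le_trans _ dK)// /K.
by have := ltW d0; lra.
Qed.

(** Interpolation between the uniform distance and the L1 distance, which is at
    most 2. *)
Lemma uniform_Lp_close (p e : R) : 1 < p -> 0 < e ->
  exists2 d : R, 0 < d & forall u v : 'rV[R]_n -> R,
    lebesgue_measurable u -> lebesgue_measurable v ->
    (forall x, 0 <= u x) -> (forall x, 0 <= v x) ->
    (\int[lam]_x (u x)%:E <= 1)%E -> (\int[lam]_x (v x)%:E <= 1)%E ->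
    (forall x, `|u x - v x| <= d) ->
    (Lp_norm [set: 'rV[R]_n] p%:E (u \- v)%R <= e%:E)%E.
Proof.
move=> p1 e0; have p0 : 0 < p by lra.
have q0 : 0 < p - 1 by rewrite subr_gt0.
have ep0 : 0 < e `^ p / 2 by rewrite divr_gt0// powR_gt0.
(* Chosen so that [d `^ (p - 1) * 2 = e `^ p], the L1 distance being at most
   2. *)
pose d := (e `^ p / 2) `^ (p - 1)^-1.
have d0 : 0 < d by rewrite powR_gt0.
have dE : d `^ (p - 1) = e `^ p / 2.
  by rewrite -powRrM mulVf ?gt_eqF// powRr1// ltW.
exists d => // u v mu mv u0 v0 u1 v1 uv.
apply: Lp_norm_le => //; first exact: ltW.
have muv : lebesgue_measurable (u \- v) by exact: measurable_funB.
have ile : (\int[lam]_x `|u x - v x|%:E <= 2%:E)%E.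
  have mabs : measurable_fun [set: lebesgueRn R n] (fun x => `|u x - v x|).
    exact: measurableT_comp muv.
  have msum : measurable_fun [set: lebesgueRn R n] (fun x => u x + v x).
    exact: measurable_funD.
  have le1 x : `|u x - v x| <= u x + v x.
    by have := u0 x; have := v0 x; rewrite ler_norml; lra.
  apply: le_trans (@ge0_le_integral_real _ _ _ lam _ _ mabs msum
    (fun x => normr_ge0 _) le1) _.
  rewrite (@ge0_integral_realD _ _ _ lam _ _ mu mv u0 v0).
  by rewrite -[2%:E]/((1 + 1)%:E) EFinD leeD.
have := @integral_powR_interpolation _ _ _ lam _ p d 2 p1 (ltW d0) muv uv ile.
by rewrite dE divfK.
Qed.

Lemma approx_Lp (f : 'rV[R]_n -> R) (p : R) : pdf f -> 1 < p ->
  (Lp_norm [set: 'rV[R]_n] p%:E f < +oo)%E ->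
  exists2 h, mixture_seq g h &
    Lp_norm [set: 'rV[R]_n] p%:E (f \- h m) @[m --> \oo] --> 0%E.
Proof.
move=> pf p1 fp; have [mf f0 f1] := pf; have p0 : 0 < p by lra.
have cf : completion_measurable (@lebesgue_borel R n) f.
  move=> B mB; apply: lebesgue_completion.
  by have := mf measurableT B mB; rewrite setTI.
have [phi [mphi phi0 phif phiE]] :=
  @completion_minorant _ _ _ (@lebesgue_borel R n) f f0 cf.
apply: (mixture_seq_approx (D := fun h => Lp_norm setT p%:E (f \- h))).
  by move=> h; exact: Lp_norm_ge0.
move=> e e0; have e30 : 0 < e / 3 by rewrite divr_gt0.
have mt k := borel_lebesgue_measurable_fun (truncation_measurable k mphi).
have fpoo : (\int[lam]_x (`|f x| `^ p)%:E < +oo)%E.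
  have <- : (Lp_norm setT p%:E f `^ p = \int[lam]_x (`|f x| `^ p)%:E)%E.
    by rewrite Lp_normTE poweR_Lnorm ?gt_eqF//; exact: eq_integral.
  exact: poweR_lty.
have tf k x : 0 <= truncation phi k x <= f x.
  by rewrite truncation_ge0//= (le_trans (truncation_le _ _ _)).
have tE : {ae lam, forall x, \forall k \near \oo, truncation phi k x = f x}.
  have [N [mN N0 NP]] := phiE.
  exists N; split => //; first exact: borel_lebesgue_measurable.
  move=> x nE; apply: NP => pE; apply: nE => /=.
  by rewrite -pE; exact: truncation_eq.
have := @Lp_dominated _ _ _ lam f (truncation phi) p p0 mf mt tf tE fpoo.
have ep0 : 0 < (e / 3) `^ p by rewrite powR_gt0.
move=> /cvge0_near_le /(_ _ ep0)[k _ /(_ k (leqnn k)) fk].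
have fk' : (Lp_norm setT p%:E (f \- truncation phi k)%R <= (e / 3)%:E)%E.
  by apply: Lp_norm_le => //; exact: ltW.
have t0 x : 0 <= truncation phi k x <= k%:R.
  by rewrite truncation_ge0// truncation_bound.
have t1 : (\int[lam]_x (truncation phi k x)%:E <= 1)%E.
  have tfk x : truncation phi k x <= f x by have /andP[] := tf k x.
  have := @ge0_le_integral_real _ _ _ lam _ f (mt k) mf
    (truncation_ge0 phi0 k) tfk.
  by rewrite f1.
have [psi [cpsi psi0 psir psi1 psik]] := approx_Lp_bounded (ltW p1)
  (truncation_measurable k mphi) t0 (ler0n _ k) (@truncation_out _ _ phi k) t1 e30.
have [d d0 dP] := uniform_Lp_close p1 e30.
have [m [h [m0 mh hP]]] :=
  approx_compact_support n_gt0 pdf_g cg vg cpsi psi0 psir psi1 d0.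
have [mhm h0 h1] := mixture_pdf pdf_g mh.
have mpsi := continuous_lebesgue_measurable cpsi.
exists m, h; split => //.
have hpsi : (Lp_norm setT p%:E (psi \- h)%R <= (e / 3)%:E)%E.
  by apply: dP => //; rewrite h1.
have -> : f \- h =
    (f \- truncation phi k) \+ ((truncation phi k \- psi) \+ (psi \- h)).
  by apply/funext => x /=; ring.
have m1 : lebesgue_measurable (f \- truncation phi k).
  exact: measurable_funB mf (mt k).
have m2 : lebesgue_measurable (truncation phi k \- psi).
  exact: measurable_funB (mt k) mpsi.
have m3 : lebesgue_measurable (psi \- h) by exact: measurable_funB mpsi mhm.
have m23 : lebesgue_measurable ((truncation phi k \- psi) \+ (psi \- h)).
  exact: measurable_funD m2 m3.
apply: le_trans (Lp_normD (ltW p1) m1 m23) _.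
apply: le_trans (leeD fk' (le_trans (Lp_normD (ltW p1) m2 m3) (leeD psik hpsi))) _.
by rewrite -!EFinD lee_fin; lra.
Qed.

(** The sequence that converges almost everywhere also works here, by
    [scheffe]. *)
Lemma approx_L1 (f : 'rV[R]_n -> R) : pdf f ->
  exists2 h, mixture_seq g h &
    Lp_norm [set: 'rV[R]_n] 1%:E (f \- h m) @[m --> \oo] --> 0%E.
Proof.
move=> pf; have [h hm hf] := approx_ae_lebesgue n_gt0 pdf_g cg vg pf.
exists h => //; have [mf f0 f1] := pf.
have ph k := mixture_pdf pdf_g (hm k.+1 isT).
rewrite -cvg_shiftS.
rewrite (_ : (fun k => _) =
    (fun k => \int[lam]_x `|f x - h k.+1 x|%:E)%E); last first.
  by apply/funext => k; rewrite Lp_normTE Lnorm1.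
apply: (@scheffe _ _ _ lam f (fun k => h k.+1)) => //.
- by move=> k; have [] := ph k.
- by move=> k x; have [_ + _] := ph k; exact.
- by move=> k; have [] := ph k.
have [N [mN N0 NP]] := hf; exists N; split => // x nE.
apply: NP => hx; apply: nE => /=.
exact: (eq_ind_r id hx (cvg_shiftS (fun m => h m x) (nbhs (f x)))).
Qed.

End LpApproximation.

Theorem theorem5 (R : realType) (n : nat) (n_gt0 : (0 < n)%N)
    (f g : 'rV[R]_n -> R) (pdf_f : pdf f) (pdf_g : pdf g) :
  (classC0 g ->
    [/\ (* (a) *)
        classC0 f ->
        exists2 h, mixture_seq g h &
          Lp_norm [set: 'rV[R]_n] +oo (f \- h m) @[m --> \oo] --> 0%E,
        (* (b) *)
        forall K : set 'rV[R]_n, classCb f -> compact K ->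
        exists2 h, mixture_seq g h &
          Lp_norm K +oo (f \- h m) @[m --> \oo] --> 0%E,
        (* (c) *)
        forall p : R, 1 < p -> (Lp_norm [set: 'rV[R]_n] p%:E f < +oo)%E ->
        exists2 h, mixture_seq g h &
          Lp_norm [set: 'rV[R]_n] p%:E (f \- h m) @[m --> \oo] --> 0%E,
        (* (d) *)
        lebesgue_measurable f ->
        exists2 h, mixture_seq g h &
          {ae lebesgue R n, forall x, h m x @[m --> \oo] --> f x} &
        (* (e) *)
        forall nu : {sigma_finite_measure set (borelRn R n) -> \bar R},
        completion_measurable nu f ->
        exists2 h, mixture_seq g h &
          {ae nu, forall x, h m x @[m --> \oo] --> f x}]) /\
  (classV g ->
    (* (f) *)
    continuous f ->
    exists2 h, mixture_seq g h &
      Lp_norm [set: 'rV[R]_n] 1%:E (f \- h m) @[m --> \oo] --> 0%E).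
Proof.
split=> [C0g|[C0g _] _]; have [cg _] := C0g; have vg := classC0_vanishing pdf_g C0g.
- split.
  + by move=> C0f; exact: approx_C0 pdf_f C0f.1 (classC0_vanishing pdf_g C0f).
  + by move=> K [cf _] cK; exact: approx_compact.
  + by move=> p p1 fp; exact: approx_Lp.
  + by move=> _; exact: approx_ae_lebesgue.
  + by move=> nu cf; exact: approx_ae.
- exact: approx_L1.
Qed.
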